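(* Let $(\mathcal{X},\mathcal{F},\sigma)$ be a sigma-finite measure space with an atomic filtration $(\mathcal{F}_n)_{n\in\mathbb{Z}}$ and let $\mathcal{D}$ be its collection of atoms. Let $W$ be a $d\times d$ matrix-valued weight on $\mathcal{X}$ and let $A_I$, $I\in\mathcal{D}$, be a family of positive semidefinite $d\times d$ matrices. Then the following are equivalent: (i) there is a finite constant $A$ such that for all $f\in L^2$ $$\sum_{I\in\mathcal{D}}\bigl\|A_I^{1/2}\langle W^{1/2}f\rangle_I\bigr\|^2|I|\le A\,\|f\|_{L^2}^2;$$ (ii) there is a finite constant $A$ such that for all $f\in L^2(W)$ $$\sum_{I\in\mathcal{D}}\bigl\|A_I^{1/2}\langle Wf\rangle_I\bigr\|^2|I|\le A\,\|f\|_{L^2(W)}^2$$ (with the same constant $A$ as in (i)); (iii) there is a finite constant $B$ such that for all $I_0\in\mathcal{D}$ $$\frac1{|I_0|}\sum_{I\in\mathcal{D},\ I\subset I_0}\langle W\rangle_I A_I\langle W\rangle_I\,|I|\le B\,\langle W\rangle_{I_0}.$$ Moreover, the best (smallest) constants $A$ and $B$ satisfy $B\le A\le C B$, where $C=C(d)=4e^2d^2$.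
   Context: Fix $\mathbb{F}=\mathbb{R}$ or $\mathbb{C}$; matrices have entries in $\mathbb{F}$, vectors lie in $\mathbb{F}^d$ with its standard inner product $\langle\cdot,\cdot\rangle$ and norm $\|\cdot\|$. Positive semidefinite matrices are self-adjoint, and inequalities between matrices are in the sense of positive semidefinite (Loewner) order. Atomic filtration: $(\mathcal{F}_n)_{n\in\mathbb{Z}}$ is an increasing sequence of sigma-algebras $\mathcal{F}_n\subset\mathcal{F}$ such that for each $n$ there is a countable collection $\mathcal{D}_n\subset\mathcal{F}_n$ of disjoint sets of finite $\sigma$-measure such that every set of $\mathcal{F}_n$ is a union of sets in $\mathcal{D}_n$. The elements of $\mathcal{D}_n$ are called atoms, and $\mathcal{D}=\bigcup_{n\in\mathbb{Z}}\mathcal{D}_n$ is the collection of all atoms. A set may belong to several $\mathcal{D}_n$; formally an atom is a pair $(I,n)$ with $I\in\mathcal{D}_n$, written simply $I$, with $\operatorname{rk} I:=n$, and sums and families indexed by $\mathcal{D}$ are indexed by such pairs. For atoms, $I\subset J$ means set inclusion together with $\operatorname{rk} I\ge\operatorname{rk} J$. A $d\times d$ matrix weight $W$ is a measurable function on $\mathcal{X}$ with values in the positive semidefinite $d\times d$ matrices which is integrable (with respect to $\sigma$) on every atom. Notation: $|E|=\sigma(E)$. For a scalar, vector or matrix-valued function $g$, $\langle g\rangle_I:=\sigma(I)^{-1}\int_I g\,d\sigma$ if $\sigma(I)>0$, and $\langle g\rangle_I:=0$ if $\sigma(I)=0$. For $|I_0|=0$ the inequality in (iii) is regarded as trivially true.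 $L^2$ is the space of measurable $\mathbb{F}^d$-valued functions with $\|f\|_{L^2}^2=\int_{\mathcal{X}}\|f\|^2\,d\sigma<\infty$; $L^2(W)$ is the space of measurable $\mathbb{F}^d$-valued functions with $\|f\|_{L^2(W)}^2=\int_{\mathcal{X}}\langle Wf,f\rangle\,d\sigma<\infty$ (modulo functions of norm $0$). *)

(* Defs.v *)
From HB Require Import structures.
From mathcomp Require Import all_boot all_order all_algebra.
From mathcomp Require Import finmap.
From mathcomp Require Import all_classical all_reals all_analysis.
From mathcomp Require Import complex.
From mathcomp Require Import showcase.summability.
Set Implicit Arguments.
Unset Strict Implicit.
Unset Printing Implicit Defensive.
Import Order.TTheory GRing.Theory Num.Theory.
Import numFieldNormedType.Exports.
Local Open Scope classical_set_scope.
Local Open Scope ring_scope.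

(* A common interface to the two scalar fields, so that every notion below is
   defined once; only real_scalars and complex_scalars are ever used. *)
Record scalars (R : realType) := Scalars {
  scalar :> numFieldType ;
  re : scalar -> R ;
  im : scalar -> R ;
  of_re_im : R -> R -> scalar }.

Definition real_scalars (R : realType) : scalars R :=
  @Scalars R R (fun a => a) (fun=> 0) (fun a _ => a).

Definition complex_scalars (R : realType) : scalars R :=
  @Scalars R R[i] (@complex.Re R) (@complex.Im R) (@complex.Complex R).

Arguments of_re_im {R} s _ _.

Section LinearAlgebra.
Context (R : realType) (F : scalars R).

Definition of_real (a : R) : F := of_re_im F a 0.
Definition conj (z : F) : F := of_re_im F (re z) (- im z).

Definition adjoint m n (M : 'M[F]_(m, n)) : 'M[F]_(n, m) := (map_mx conj M)^T.

Definition inner d (u v : 'cV[F]_d) : F := \sum_(i < d) u i 0 * conj (v i 0).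
Definition vnorm d (u : 'cV[F]_d) : R := Num.sqrt (re (inner u u)).

(* In the order of a numFieldType, 0 <= z also says that z is real. *)
Definition psd d (M : 'M[F]_d) : Prop :=
  adjoint M = M /\ forall v : 'cV[F]_d, 0 <= inner (M *m v) v.

Definition loewner_le d (M N : 'M[F]_d) : Prop := psd (N - M).

(* The unique positive semidefinite S with S ^ 2 = M, for M positive
   semidefinite; the default value 0 is only taken when M is not. *)
Definition psd_sqrt d (M : 'M[F]_d) : 'M[F]_d :=
  xget 0 [set S : 'M[F]_d | psd S /\ S *m S = M].

(* Unconditional convergence: S is the limit of the partial sums along the
   finite subsets of D, directed by inclusion. *)
Definition has_sum_mx (T : choiceType) (D : set T) d (M : T -> 'M[F]_d)
    (S : 'M[F]_d) : Prop :=
  (fun J : {fset T} => \sum_(p <- J | p \in D) M p) @ totally --> S.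

End LinearAlgebra.

Section Integration.
Context (R : realType) (F : scalars R).
Context (disp : measure_display) (X : measurableType disp).
Context (sigma : {measure set X -> \bar R}).

Definition measurable_mx m n (G : X -> 'M[F]_(m, n)) : Prop :=
  forall i j, measurable_fun setT (fun x => re (G x i j)) /\
              measurable_fun setT (fun x => im (G x i j)).

Definition integrable_mx (E : set X) m n (G : X -> 'M[F]_(m, n)) : Prop :=
  forall i j, sigma.-integrable E (fun x => (re (G x i j))%:E) /\
              sigma.-integrable E (fun x => (im (G x i j))%:E).

Definition integral_mx (E : set X) m n (G : X -> 'M[F]_(m, n)) :
    'M[F]_(m, n) :=
  \matrix_(i, j) of_re_im F (\int[sigma]_(x in E) re (G x i j))
                            (\int[sigma]_(x in E) im (G x i j)).

Definition average (E : set X) m n (G : X -> 'M[F]_(m, n)) : 'M[F]_(m, n) :=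
  if sigma E == 0%E then 0
  else of_real F (fine (sigma E))^-1 *: integral_mx E G.

Definition sqnorm_L2 d (f : X -> 'cV[F]_d) : \bar R :=
  (\int[sigma]_x (vnorm (f x) ^+ 2)%:E)%E.

Definition in_L2 d (f : X -> 'cV[F]_d) : Prop :=
  measurable_mx f /\ (sqnorm_L2 f < +oo)%E.

Definition sqnorm_L2W d (W : X -> 'M[F]_d) (f : X -> 'cV[F]_d) : \bar R :=
  (\int[sigma]_x (re (inner (W x *m f x) (f x)))%:E)%E.

Definition in_L2W d (W : X -> 'M[F]_d) (f : X -> 'cV[F]_d) : Prop :=
  measurable_mx f /\ (sqnorm_L2W W f < +oo)%E.

End Integration.

Record atomic_filtration (R : realType) (disp : measure_display)
    (X : measurableType disp) (sigma : {measure set X -> \bar R}) := {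
  salgebra : int -> set (set X) ;
  atoms : int -> set (set X) ;
  salgebraP : forall n, sigma_algebra setT (salgebra n) ;
  salgebra_measurable : forall n, salgebra n `<=` measurable ;
  salgebra_incr : forall m n, (m <= n)%R -> salgebra m `<=` salgebra n ;
  atoms_salgebra : forall n, atoms n `<=` salgebra n ;
  atoms_countable : forall n, countable (atoms n) ;
  atoms_disjoint : forall n, trivIset (atoms n) id ;
  atoms_finite : forall n I, atoms n I -> (sigma I < +oo)%E ;
  atoms_cover : forall n E, salgebra n E ->
    exists2 P : set (set X), P `<=` atoms n & E = \bigcup_(I in P) I }.

Section Embedding.
Context (R : realType) (F : scalars R).
Context (disp : measure_display) (X : measurableType disp).
Context (sigma : {measure set X -> \bar R}) (Fil : atomic_filtration sigma).

(* Atoms are pairs (set, rank). *)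
Definition all_atoms : set (set X * int) := [set I | atoms Fil I.2 I.1].

Definition atoms_in (I0 : set X * int) : set (set X * int) :=
  [set I | all_atoms I /\ I.1 `<=` I0.1 /\ (I0.2 <= I.2)%R].

Definition matrix_weight d (W : X -> 'M[F]_d) : Prop :=
  [/\ measurable_mx W, forall x, psd (W x) &
      forall I, all_atoms I -> integrable_mx sigma I.1 W].

Context (d : nat) (W : X -> 'M[F]_d) (A : set X * int -> 'M[F]_d).

Definition carleson_sum (g : X -> 'cV[F]_d) : \bar R :=
  \esum_(I in all_atoms)
    ((vnorm (psd_sqrt (A I) *m average sigma I.1 g) ^+ 2)%:E * sigma I.1)%E.

Definition embedding_L2 (c : R) : Prop :=
  forall f : X -> 'cV[F]_d, in_L2 sigma f ->
    (carleson_sum (fun x => psd_sqrt (W x) *m f x)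
       <= c%:E * sqnorm_L2 sigma f)%E.

Definition embedding_L2W (c : R) : Prop :=
  forall f : X -> 'cV[F]_d, in_L2W sigma W f ->
    (carleson_sum (fun x => W x *m f x) <= c%:E * sqnorm_L2W sigma W f)%E.

(* The sum is required to converge, and no condition is imposed when
   |I0| = 0. *)
Definition carleson_packing (c : R) : Prop :=
  forall I0, all_atoms I0 -> sigma I0.1 != 0%E ->
    exists2 S : 'M[F]_d,
      has_sum_mx (atoms_in I0) (fun I => of_real F (fine (sigma I.1)) *:
        (average sigma I.1 W *m A I *m average sigma I.1 W)) S &
      loewner_le (of_real F (fine (sigma I0.1))^-1 *: S)
                 (of_real F c *: average sigma I0.1 W).

End Embedding.

(* Constants are nonnegative: if every right-hand side vanishes then any
   negative number would do as well, and there would be no smallest one. *)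
Definition admissible (R : realType) (P : R -> Prop) (c : R) : Prop :=
  0 <= c /\ P c.

Definition best_constant (R : realType) (P : R -> Prop) (c : R) : Prop :=
  admissible P c /\ forall c', admissible P c' -> c <= c'.

(* Main.v *)
(* Only the implication from the packing condition, with constant B, to the
   embedding needs work. Write h = W f, let M_I be the average over I of the
   packing sum, so that 0 <= M_I <= B <W>_I, and for 0 < t < 1 put
   U_I = t B <W>_I + (1 - t) M_I. The function <U_I^-1 <h>_I, <h>_I> is
   superadditive along the filtration, and its defect yields
     sum_I |I| |A_I^(1/2) <W>_I U_I(t)^-1 <h>_I|^2 <= |f|^2 / (B t (1 - t)),
   whereas the embedding is the case t = 1, up to the factor B. One extrapolates
   to t = 1: det U_I(t) * U_I(t)^-1 is a polynomial of degree less than d in t,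
   and det U_I(t) <= det U_I(1), so the Riesz interpolation formula for sine
   polynomials, with t = (1 + cos psi) / 2, costs only a factor (2 d)^2 in the
   squared norm; this gives the constant 4 d^2. The average <W>_I is replaced by
   <W>_I + e with e > 0 to make U_I(t) invertible. The two embeddings are compared
   by duality, and only finitely many atoms are considered at a time. *)

Require Import Defs.
From mathcomp Require Import all_boot all_order all_algebra.
From mathcomp Require Import finmap perm.
From mathcomp Require Import all_classical all_reals all_analysis.
From mathcomp Require Import measurable_realfun.
From mathcomp Require Import complex showcase.summability.
From mathcomp Require Import ring lra zify.
Import Order.TTheory GRing.Theory Num.Theory.
Import numFieldNormedType.Exports.
Local Open Scope classical_set_scope.
Local Open Scope ring_scope.
Set Implicit Arguments.
Unset Strict Implicit.
Unset Printing Implicit Defensive.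

(** * Scalars and quadratic forms *)

(** The factors 1/t and 1/(1 - t) have separate origins. The bound U_I(t) >= t B <W>_I keeps the
    Bellman function below |f|^2 / (t B). The term of I itself is counted in M_I but not in the
    parts below I, and this jump enters U_I with weight 1 - t. The estimate is therefore empty at t
    = 1, where it is wanted. What stays bounded is sqrt (t (1 - t)) times the vector; in the
    variable psi this is half of sin psi times a polynomial in cos psi of degree less than d, and
    the derivative of such a product at psi = 0 is the value of the polynomial at t = 1. So a
    derivative of a sine polynomial of degree at most d has to be bounded, and the Riesz
    coefficients for it have absolute sum d. Dividing by det U_I(1) in place of det U_I(t) only
    shrinks the coefficients. *)

Class real_or_complex (R : realType) (F : scalars R) : Prop :=
  real_or_complexP : F = real_scalars R \/ F = complex_scalars R.

Section Scalars.
Context {R : realType} {F : scalars R} {hF : real_or_complex F}.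
Implicit Types (z w : F) (a b : R).

Lemma reD z w : re (z + w) = re z + re w.
Proof. by case: hF z w => -> //= -[a b] [c e]. Qed.

Lemma imD z w : im (z + w) = im z + im w.
Proof. by case: hF z w => -> /=; [move=> *; rewrite addr0|move=> -[a b] [c e]]. Qed.

Lemma reN z : re (- z) = - re z.
Proof. by case: hF z => -> //= -[a b]. Qed.

Lemma imN z : im (- z) = - im z.
Proof. by case: hF z => -> /=; [move=> *; rewrite oppr0|move=> -[a b]]. Qed.

Lemma re0 : re (0 : F) = 0.
Proof. by case: hF => ->. Qed.

Lemma im0 : im (0 : F) = 0.
Proof. by case: hF => ->. Qed.

Lemma re1 : re (1 : F) = 1.
Proof. by case: hF => ->. Qed.

Lemma im1 : im (1 : F) = 0.
Proof. by case: hF => ->. Qed.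

Lemma reM z w : re (z * w) = re z * re w - im z * im w.
Proof.
by case: hF z w => -> /=; [move=> *; rewrite mulr0 subr0|move=> -[a b] [c e]].
Qed.

Lemma imM z w : im (z * w) = re z * im w + im z * re w.
Proof.
by case: hF z w => -> /=; [move=> *; rewrite mulr0 mul0r addr0|move=> -[a b] [c e]].
Qed.

Lemma of_re_imK z : of_re_im F (re z) (im z) = z.
Proof. by case: hF z => -> //= -[a b]. Qed.

Lemma re_of a b : re (of_re_im F a b) = a.
Proof. by case: hF => ->. Qed.

Lemma re_im_inj z w : re z = re w -> im z = im w -> z = w.
Proof. by move=> er ei; rewrite -[z]of_re_imK -[w]of_re_imK er ei. Qed.

Lemma re_of_real a : re (of_real F a) = a.
Proof. exact: re_of. Qed.

Lemma im_of_real a : im (of_real F a) = 0.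
Proof. by rewrite /of_real; case: hF => ->. Qed.

Lemma re_conj z : re (conj z) = re z.
Proof. exact: re_of. Qed.

Lemma im_conj z : im (conj z) = - im z.
Proof. by rewrite /conj; case: hF z => -> /=; rewrite ?oppr0. Qed.

Lemma re_sum I (r : seq I) (P : pred I) (f : I -> F) :
  re (\sum_(i <- r | P i) f i) = \sum_(i <- r | P i) re (f i).
Proof. by apply: (big_morph _ reD re0). Qed.

Lemma im_sum I (r : seq I) (P : pred I) (f : I -> F) :
  im (\sum_(i <- r | P i) f i) = \sum_(i <- r | P i) im (f i).
Proof. by apply: (big_morph _ imD im0). Qed.

Lemma conjM z w : conj (z * w) = conj z * conj w.
Proof.
by apply: re_im_inj; rewrite !(re_conj, im_conj, reM, imM);
  [rewrite mulrNN|rewrite mulrN mulNr opprD].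
Qed.

Lemma conjD z w : conj (z + w) = conj z + conj w.
Proof.
by apply: re_im_inj; rewrite !(re_conj, im_conj, reD, imD) // opprD.
Qed.

Lemma conj0 : conj (0 : F) = 0.
Proof. by apply: re_im_inj; rewrite !(re_conj, im_conj) // im0 oppr0. Qed.

Lemma conjK : involutive (@conj R F).
Proof. by move=> z; apply: re_im_inj; rewrite !(re_conj, im_conj) // opprK. Qed.

Lemma conj_sum I (r : seq I) (P : pred I) (f : I -> F) :
  conj (\sum_(i <- r | P i) f i) = \sum_(i <- r | P i) conj (f i).
Proof. by apply: (big_morph _ conjD conj0). Qed.

Lemma conj_of_real a : conj (of_real F a) = of_real F a.
Proof.
by apply: re_im_inj; rewrite !(re_conj, im_conj) // im_of_real oppr0.
Qed.

Lemma of_realD a b : of_real F (a + b) = of_real F a + of_real F b.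
Proof.
by apply: re_im_inj; rewrite !(reD, imD) ?re_of_real ?im_of_real // addr0.
Qed.

Lemma of_realM a b : of_real F (a * b) = of_real F a * of_real F b.
Proof.
apply: re_im_inj; rewrite !(reM, imM) ?re_of_real ?im_of_real.
  by rewrite mulr0 subr0.
by rewrite mulr0 mul0r addr0.
Qed.

Lemma of_real0 : of_real F 0 = 0.
Proof. by apply: re_im_inj; rewrite ?re_of_real ?im_of_real ?re0 ?im0. Qed.

Lemma of_real1 : of_real F 1 = 1.
Proof. by apply: re_im_inj; rewrite ?re_of_real ?im_of_real ?re1 ?im1. Qed.

Lemma of_realN a : of_real F (- a) = - of_real F a.
Proof.
by apply: re_im_inj; rewrite !(reN, imN) ?re_of_real ?im_of_real // oppr0.
Qed.

Lemma of_real_sum I (r : seq I) (P : pred I) (f : I -> R) :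
  of_real F (\sum_(i <- r | P i) f i) = \sum_(i <- r | P i) of_real F (f i).
Proof. by apply: (big_morph _ of_realD of_real0). Qed.

Lemma of_realX a n : of_real F (a ^+ n) = of_real F a ^+ n.
Proof. by elim: n => [|n IH]; rewrite ?expr0 ?of_real1 // !exprS of_realM IH. Qed.

Lemma of_real_eq0 a : (of_real F a == 0) = (a == 0).
Proof.
apply/eqP/eqP => [h|->]; last exact: of_real0.
by rewrite -[a]re_of_real h re0.
Qed.

Lemma of_realV a : of_real F a^-1 = (of_real F a)^-1.
Proof.
have [->|a0] := eqVneq a 0; first by rewrite invr0 of_real0 invr0.
have b0 : of_real F a != 0 by rewrite of_real_eq0.
by apply: (@mulIf _ (of_real F a)) => //; rewrite -of_realM !mulVf // of_real1.
Qed.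

Lemma ge0_re_im z : (0 <= z) = (0 <= re z) && (im z == 0).
Proof.
case: hF z => -> /= z; first by rewrite eqxx andbT.
by rewrite lecE /= andbC.
Qed.

Lemma of_real_ge0 a : (0 <= of_real F a) = (0 <= a).
Proof. by rewrite ge0_re_im re_of_real im_of_real eqxx andbT. Qed.

Lemma of_real_le a b : (of_real F a <= of_real F b) = (a <= b).
Proof. by rewrite -subr_ge0 -of_realN -of_realD of_real_ge0 subr_ge0. Qed.

Lemma of_real_lt a b : (of_real F a < of_real F b) = (a < b).
Proof.
rewrite !lt_neqAle of_real_le -subr_eq0 -of_realN -of_realD of_real_eq0.
by rewrite subr_eq0.
Qed.

Lemma norm_of_real a : `|of_real F a| = of_real F `|a|.
Proof.
case: (leP 0 a) => a0.
  by rewrite !ger0_norm // of_real_ge0.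
rewrite ltr0_norm; last by rewrite -of_real0 of_real_lt.
by rewrite (ltr0_norm a0) of_realN.
Qed.

Lemma norm_re z : of_real F `|re z| <= `|z|.
Proof.
rewrite /of_real; case: hF z => -> //= z.
exact: normc_ge_Re.
Qed.

Lemma norm_im z : of_real F `|im z| <= `|z|.
Proof.
rewrite /of_real; case: hF z => -> /= z; first by rewrite normr0.
rewrite normc_def lecR -sqrtr_sqr.
by rewrite ler_wsqrtr // lerDr sqr_ge0.
Qed.

End Scalars.

Section Forms.
Context {R : realType} {F : scalars R} {hF : real_or_complex F}.

(** The inner product of the underlying real vector space: hermitian forms are real, and the
    variational estimates involve real parts only. *)
Definition dot d (u v : 'cV[F]_d) : R := re (inner u v).

Lemma adjointD m n (M N : 'M[F]_(m, n)) :
  adjoint (M + N) = adjoint M + adjoint N.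
Proof. by apply/matrixP => i j; rewrite !mxE conjD. Qed.

Lemma adjointZ m n (a : R) (M : 'M[F]_(m, n)) :
  adjoint (of_real F a *: M) = of_real F a *: adjoint M.
Proof. by apply/matrixP => i j; rewrite !mxE conjM conj_of_real. Qed.

Lemma adjointN m n (M : 'M[F]_(m, n)) : adjoint (- M) = - adjoint M.
Proof.
have -> : - M = of_real F (- 1) *: M by rewrite of_realN of_real1 scaleN1r.
by rewrite adjointZ of_realN of_real1 scaleN1r.
Qed.

Lemma adjointK m n (M : 'M[F]_(m, n)) : adjoint (adjoint M) = M.
Proof. by apply/matrixP => i j; rewrite !mxE conjK. Qed.

Lemma adjointM m n p (M : 'M[F]_(m, n)) (N : 'M[F]_(n, p)) :
  adjoint (M *m N) = adjoint N *m adjoint M.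
Proof.
apply/matrixP => i j; rewrite !mxE conj_sum; apply: eq_bigr => k _.
by rewrite !mxE conjM mulrC.
Qed.

Lemma adjoint0 m n : adjoint (0 : 'M[F]_(m, n)) = 0.
Proof. by apply/matrixP => i j; rewrite !mxE conj0. Qed.

Lemma adjoint_scalar d (a : R) :
  adjoint (of_real F a)%:M = (of_real F a)%:M :> 'M[F]_d.
Proof.
apply/matrixP => i j; rewrite !mxE eq_sym.
by case: (i == j); rewrite ?mulr1n ?mulr0n ?conj_of_real ?conj0.
Qed.

Lemma adjoint1 d : adjoint (1%:M) = 1%:M :> 'M[F]_d.
Proof. by rewrite -of_real1 adjoint_scalar. Qed.

Section Dot.
Variable d : nat.
Implicit Types (u v w : 'cV[F]_d) (M N : 'M[F]_d) (a b : R).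

Lemma innerE u v : inner u v = (adjoint v *m u) 0 0.
Proof.
by rewrite !mxE; apply: eq_bigr => i _; rewrite !mxE mulrC.
Qed.

Lemma dotE u v :
  dot u v = \sum_i (re (u i 0) * re (v i 0) + im (u i 0) * im (v i 0)).
Proof.
rewrite /dot re_sum; apply: eq_bigr => i _.
by rewrite reM re_conj im_conj mulrN opprK.
Qed.

Lemma dotC u v : dot u v = dot v u.
Proof. by rewrite !dotE; apply: eq_bigr => i _; rewrite mulrC [im _ * _]mulrC. Qed.

Lemma dotDl u v w : dot (u + v) w = dot u w + dot v w.
Proof. by rewrite /dot !innerE mulmxDr mxE reD. Qed.

Lemma dotDr u v w : dot w (u + v) = dot w u + dot w v.
Proof. by rewrite !(dotC w) dotDl. Qed.

Lemma dotZl a u v : dot (of_real F a *: u) v = a * dot u v.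
Proof.
by rewrite /dot !innerE -scalemxAr mxE reM re_of_real im_of_real mul0r subr0.
Qed.

Lemma dotZr a u v : dot u (of_real F a *: v) = a * dot u v.
Proof. by rewrite !(dotC u) dotZl. Qed.

Lemma dotNl u v : dot (- u) v = - dot u v.
Proof. by rewrite /dot !innerE mulmxN mxE reN. Qed.

Lemma dotNr u v : dot u (- v) = - dot u v.
Proof. by rewrite !(dotC u) dotNl. Qed.

Lemma dot0l v : dot 0 v = 0.
Proof. by rewrite /dot innerE mulmx0 mxE re0. Qed.

Lemma dot0r v : dot v 0 = 0.
Proof. by rewrite dotC dot0l. Qed.

Lemma dot_suml I (r : seq I) (P : pred I) (f : I -> 'cV[F]_d) v :
  dot (\sum_(i <- r | P i) f i) v = \sum_(i <- r | P i) dot (f i) v.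
Proof. by apply: (big_morph (fun u => dot u v) (fun x y => dotDl x y v) (dot0l v)). Qed.

Lemma dot_sumr I (r : seq I) (P : pred I) (f : I -> 'cV[F]_d) v :
  dot v (\sum_(i <- r | P i) f i) = \sum_(i <- r | P i) dot v (f i).
Proof. by rewrite dotC dot_suml; apply: eq_bigr => i _; rewrite dotC. Qed.

Lemma dot_ge0 u : 0 <= dot u u.
Proof. by rewrite dotE sumr_ge0 // => i _; rewrite addr_ge0 // -expr2 sqr_ge0. Qed.

Lemma dot_eq0 u : dot u u = 0 -> u = 0.
Proof.
rewrite dotE => /eqP; rewrite psumr_eq0 => [|i _]; last first.
  by rewrite addr_ge0 // -expr2 sqr_ge0.
move=> /allP h; apply/matrixP => i j; rewrite ord1 !mxE.
have /h /= := mem_index_enum i.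
rewrite -!expr2 paddr_eq0 ?sqr_ge0 // !sqrf_eq0 => /andP[/eqP a /eqP b].
by apply: re_im_inj; rewrite ?a ?b ?re0 ?im0.
Qed.

Lemma vnormE u : vnorm u ^+ 2 = dot u u.
Proof. by rewrite sqr_sqrtr // dot_ge0. Qed.

Lemma dot_adjoint M u v : dot (M *m u) v = dot u (adjoint M *m v).
Proof. by rewrite /dot !innerE adjointM adjointK mulmxA. Qed.

Lemma inner_conj u v : conj (inner u v) = inner v u.
Proof.
rewrite /inner conj_sum; apply: eq_bigr => i _.
by rewrite conjM conjK mulrC.
Qed.

(** For hermitian [M] the number [inner (M *m v) v] equals its own conjugate, so the inequality in
    [F] reduces to its real part. *)
Lemma psdP M :
  psd M <-> adjoint M = M /\ forall v, 0 <= dot (M *m v) v.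
Proof.
split=> [[h p]|[h p]]; split=> // v.
  by have := p v; rewrite ge0_re_im => /andP[].
rewrite ge0_re_im p /=.
have : conj (inner (M *m v) v) = inner (M *m v) v.
  by rewrite inner_conj !innerE adjointM h mulmxA.
move=> /(congr1 (@im _ F)); rewrite im_conj => e.
by apply/eqP; lra.
Qed.

Lemma psd_herm M : psd M -> adjoint M = M. Proof. by case. Qed.

Lemma psd_ge0 M v : psd M -> 0 <= dot (M *m v) v.
Proof. by move=> /psdP[]. Qed.

Lemma dot_herm M u v : adjoint M = M -> dot (M *m u) v = dot (M *m v) u.
Proof. by move=> h; rewrite dot_adjoint h dotC. Qed.

Lemma psdD M N : psd M -> psd N -> psd (M + N).
Proof.
move=> /psdP[h p] /psdP[h' p']; apply/psdP; split; first by rewrite adjointD h h'.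
by move=> v; rewrite mulmxDl dotDl addr_ge0.
Qed.

Lemma psdZ a M : 0 <= a -> psd M -> psd (of_real F a *: M).
Proof.
move=> a0 /psdP[h p]; apply/psdP; split; first by rewrite adjointZ h.
by move=> v; rewrite -scalemxAl dotZl mulr_ge0.
Qed.

Lemma psd0 : psd (0 : 'M[F]_d).
Proof. by apply/psdP; split=> [|v]; rewrite ?adjoint0 // mul0mx dot0l. Qed.

Lemma psd1 : psd (1%:M : 'M[F]_d).
Proof. by apply/psdP; split=> [|v]; rewrite ?adjoint1 // mul1mx dot_ge0. Qed.

Lemma psd_sum I (r : seq I) (P : pred I) (M : I -> 'M[F]_d) :
  (forall i, P i -> psd (M i)) -> psd (\sum_(i <- r | P i) M i).
Proof. by move=> h; elim/big_ind: _ => //; [exact: psd0|exact: psdD]. Qed.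

Lemma psd_sandwich M N : psd M -> psd (adjoint N *m M *m N).
Proof.
move=> /psdP[h p]; apply/psdP; split.
  by rewrite !adjointM adjointK h mulmxA.
by move=> v; rewrite -!mulmxA dot_adjoint adjointK.
Qed.

Lemma loewner_leP M N : adjoint M = M -> adjoint N = N ->
  loewner_le M N <-> forall v, dot (M *m v) v <= dot (N *m v) v.
Proof.
move=> hM hN; split=> [/psdP[_ p] v|p].
  by have := p v; rewrite mulmxBl dotDl dotNl subr_ge0.
apply/psdP; split; first by rewrite adjointD adjointN hM hN.
by move=> v; rewrite mulmxBl dotDl dotNl subr_ge0.
Qed.

Lemma psd_form_expand M a b u v : adjoint M = M ->
  dot (M *m (of_real F a *: u + of_real F b *: v))
      (of_real F a *: u + of_real F b *: v) =
  a ^+ 2 * dot (M *m u) u + 2 * (a * b * dot (M *m u) v)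
  + b ^+ 2 * dot (M *m v) v.
Proof.
move=> h; rewrite mulmxDr -!scalemxAr !dotDl !dotDr !dotZl !dotZr.
by rewrite (dot_herm v u h); ring.
Qed.

(** Expand the form at [a u - v] and divide by [a]. This weighted version of the Cauchy-Schwarz
    inequality stays linear in the forms, which suits summation and integration. *)
Lemma psd_mixed_le M u v a : psd M -> 0 < a ->
  2 * dot (M *m u) v <= a * dot (M *m u) u + a^-1 * dot (M *m v) v.
Proof.
move=> p a0; have := psd_ge0 (of_real F a *: u + of_real F (-1) *: v) p.
rewrite psd_form_expand ?psd_herm // => h.
rewrite -(ler_pM2l a0) mulrDr (mulrA a a^-1) mulfV ?gt_eqF // mul1r.
by lra.
Qed.

Lemma psd_dot0 M u : psd M -> dot (M *m u) u = 0 -> M *m u = 0.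
Proof.
move=> p u0; apply: dot_eq0; apply/eqP; rewrite eq_le dot_ge0 andbT leNgt.
apply/negP => n0.
set n := dot _ _ in n0; set m := dot (M *m (M *m u)) (M *m u).
have m0 : 0 <= m by exact: psd_ge0.
(* As the form vanishes at [u], the mixed inequality with [v = M u] reads [2 n <= m / a]; this [a]
   makes the right-hand side less than [n]. *)
have a0 : 0 < (m + 1) / n by rewrite divr_gt0 // ltr_wpDl.
have := psd_mixed_le u (M *m u) p a0; rewrite u0 mulr0 add0r -/n -/m.
rewrite invf_div mulrAC ler_pdivlMr ?ltr_wpDl //.
by rewrite -subr_ge0 => h; nra.
Qed.

(** The mixed inequality with parameter [al j / al i] is applied to each pair [i], [j]; the two
    halves of the resulting double sum are equal. The bounds [ga] appear because the extrapolation
    coefficients are only known up to their absolute values. *)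
Lemma psd_form_sum_le M I (r : seq I) (al be ga : I -> R) (v : I -> 'cV[F]_d) :
  psd M -> (forall i, 0 < al i) -> (forall i, `|be i| <= ga i) ->
  dot (M *m \sum_(i <- r) (of_real F (be i) *: v i))
      (\sum_(i <- r) (of_real F (be i) *: v i)) <=
  (\sum_(i <- r) al i) *
  \sum_(i <- r) (ga i ^+ 2 / al i * dot (M *m v i) (v i)).
Proof.
move=> p al0 bg; rewrite mulmx_sumr dot_suml mulr_suml.
set q := fun i => dot (M *m v i) (v i).
have q0 i : 0 <= q i by exact: psd_ge0.
have key : \sum_(i <- r) \sum_(j <- r) 2 * (be i * be j * dot (M *m v i) (v j))
  <= \sum_(i <- r) \sum_(j <- r) (al j * (ga i ^+ 2 / al i * q i) +
         al i * (ga j ^+ 2 / al j * q j)).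
  apply: ler_sum => i _; apply: ler_sum => j _.
  have a0 : 0 < al j / al i by rewrite divr_gt0.
  have := psd_mixed_le (of_real F (be i) *: v i) (of_real F (be j) *: v j) p a0.
  rewrite -!scalemxAr !dotZl !dotZr -/(q i) -/(q j) invf_div => h.
  rewrite -[be i * be j * _]mulrA; apply: (le_trans h); apply: lerD.
    have -> : al j * (ga i ^+ 2 / al i * q i) = al j / al i * (ga i ^+ 2 * q i).
      by ring.
    apply: ler_wpM2l; first exact: ltW.
    rewrite mulrA ler_wpM2r // -expr2 -[be i ^+ 2]real_normK ?num_real //.
    by rewrite lerXn2r ?nnegrE // (le_trans _ (bg i)).
  have -> : al i * (ga j ^+ 2 / al j * q j) = al i / al j * (ga j ^+ 2 * q j).
    by ring.
  apply: ler_wpM2l; first by rewrite divr_ge0 // ltW.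
  rewrite mulrA ler_wpM2r // -expr2 -[be j ^+ 2]real_normK ?num_real //.
  by rewrite lerXn2r ?nnegrE // (le_trans _ (bg j)).
rewrite -(ler_pM2l (_ : 0 < 2)) //.
apply: le_trans (_ : \sum_(i <- r) \sum_(j <- r)
   2 * (be i * be j * dot (M *m v i) (v j)) <= _).
  rewrite mulr_sumr ler_sum // => i _.
  rewrite dot_sumr -scalemxAr mulr_sumr ler_sum // => j _.
  by rewrite dotZl dotZr; lra.
apply: (le_trans key).
under eq_bigr => i _ do rewrite big_split /=.
rewrite big_split /= [X in X + _ <= _]exchange_big /=.
rewrite mulr2n mulrDl mul1r lerD //; apply: ler_sum => i _.
  by rewrite mulr_sumr.
by rewrite mulr_sumr.
Qed.

End Dot.
End Forms.

(** * Limits of hermitian matrices *)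

Section Polarization.
Context {R : realType} {F : scalars R} {hF : real_or_complex F}.

Lemma re_iM (z : F) : re (of_re_im F 0 1 * z) = - im z.
Proof.
by rewrite reM re_of mul0r sub0r; case: hF z => -> /= z; rewrite ?mul0r ?mul1r.
Qed.

Lemma dot_deltar d (u : 'cV[F]_d) i : dot u (delta_mx i 0) = re (u i 0).
Proof.
rewrite dotE (bigD1 i) //= big1 ?addr0 => [|k ki].
  by rewrite !mxE !eqxx /= re1 im1 mulr1 mulr0 addr0.
by rewrite !mxE (negPf ki) /= re0 im0 !mulr0 addr0.
Qed.

Lemma dot_ideltar d (u : 'cV[F]_d) i :
  dot u (of_re_im F 0 1 *: delta_mx i 0) = im (u i 0).
Proof.
rewrite dotE (bigD1 i) //= big1 ?addr0 => [|k ki].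
  rewrite !mxE !eqxx /= mulr1 re_of mulr0 add0r.
  by case: hF u => -> /= u; rewrite ?mulr0 ?mulr1.
by rewrite !mxE (negPf ki) /= mulr0 re0 im0 !mulr0 addr0.
Qed.

Lemma dot_delta d (M : 'M[F]_d) i j :
  dot (M *m delta_mx j 0) (delta_mx i 0) = re (M i j).
Proof. by rewrite -colE dot_deltar mxE. Qed.

Definition polar d (q : 'cV[F]_d -> R) (u v : 'cV[F]_d) : R :=
  (q (u + v) - q u - q v) / 2.

(* Over the reals [of_re_im F 0 1] is [0], so that the imaginary parts vanish. *)
Definition mx_of_form d (q : 'cV[F]_d -> R) : 'M[F]_d :=
  \matrix_(i, j) of_re_im F (polar q (delta_mx j 0) (delta_mx i 0))
    (- polar q (of_re_im F 0 1 *: delta_mx j 0) (delta_mx i 0)).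

Lemma polar_form d (M : 'M[F]_d) u v : adjoint M = M ->
  polar (fun w => dot (M *m w) w) u v = dot (M *m u) v.
Proof.
move=> h; rewrite /polar mulmxDr !dotDl !dotDr (dot_herm v u h).
by lra.
Qed.

Lemma mx_of_formK d (M : 'M[F]_d) : adjoint M = M ->
  mx_of_form (fun w => dot (M *m w) w) = M.
Proof.
move=> h; apply/matrixP => i j; rewrite mxE !polar_form //.
rewrite -[RHS]of_re_imK dot_delta; congr (of_re_im F _ _).
by rewrite -scalemxAr scalemxAl dot_delta mxE re_iM opprK.
Qed.

(** Convergence of real coordinates, to which limit theorems for real functions apply;
    [cvg_entriesP] identifies it with convergence in the matrix topology over [F]. *)
Definition cvg_entries T (G : set_system T) m n (M : T -> 'M[F]_(m, n))
    (S : 'M[F]_(m, n)) : Prop :=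
  forall i j, ((fun t => re (M t i j)) @ G --> re (S i j)) /\
              ((fun t => im (M t i j)) @ G --> im (S i j)).

Context {T : Type} {G : set_system T} {FG : ProperFilter G}.

Lemma cvg_sumR I (r : seq I) (f : I -> T -> R) (l : I -> R) :
  (forall i, f i @ G --> l i) ->
  (fun t => \sum_(i <- r) f i t) @ G --> \sum_(i <- r) l i.
Proof.
move=> h; elim: r => [|i r IH].
  by rewrite big_nil; under eq_fun do rewrite big_nil; exact: cvg_cst.
by rewrite big_cons; under eq_fun do rewrite big_cons; apply: cvgD.
Qed.

Lemma cvg_entries_mul m n p (M : T -> 'M[F]_(m, n)) (N : T -> 'M[F]_(n, p)) S U :
  cvg_entries G M S -> cvg_entries G N U ->
  cvg_entries G (fun t => M t *m N t) (S *m U).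
Proof.
move=> h h' i j; split; rewrite mxE ?re_sum ?im_sum.
- under eq_fun do rewrite mxE re_sum.
  apply: cvg_sumR => k; rewrite reM; under eq_fun do rewrite reM.
  have [a b] := h i k; have [a' b'] := h' k j.
  by apply: cvgB; apply: cvgM.
- under eq_fun do rewrite mxE im_sum.
  apply: cvg_sumR => k; rewrite imM; under eq_fun do rewrite imM.
  have [a b] := h i k; have [a' b'] := h' k j.
  by apply: cvgD; apply: cvgM.
Qed.

Lemma cvg_entries_cst m n (S : 'M[F]_(m, n)) : cvg_entries G (fun=> S) S.
Proof. by move=> i j; split; apply: cvg_cst. Qed.

Lemma cvg_entriesD m n (M N : T -> 'M[F]_(m, n)) S U :
  cvg_entries G M S -> cvg_entries G N U ->
  cvg_entries G (fun t => M t + N t) (S + U).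
Proof.
move=> h h' i j; have [a b] := h i j; have [a' b'] := h' i j.
split; rewrite mxE ?reD ?imD.
  by under eq_fun do rewrite mxE reD; apply: cvgD.
by under eq_fun do rewrite mxE imD; apply: cvgD.
Qed.

Lemma cvg_entriesZ m n (c : R) (M : T -> 'M[F]_(m, n)) S :
  cvg_entries G M S ->
  cvg_entries G (fun t => of_real F c *: M t) (of_real F c *: S).
Proof.
move=> h i j; have [a b] := h i j; split; rewrite mxE.
  rewrite reM re_of_real im_of_real mul0r subr0.
  under eq_fun do rewrite mxE reM re_of_real im_of_real mul0r subr0.
  exact: cvgMl_tmp.
rewrite imM re_of_real im_of_real mul0r addr0.
under eq_fun do rewrite mxE imM re_of_real im_of_real mul0r addr0.
exact: cvgMl_tmp.
Qed.

Lemma cvg_entriesN m n (M : T -> 'M[F]_(m, n)) S :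
  cvg_entries G M S -> cvg_entries G (fun t => - M t) (- S).
Proof.
move=> h i j; have [a b] := h i j; split; rewrite mxE ?reN ?imN.
  by under eq_fun do rewrite mxE reN; apply: cvgN.
by under eq_fun do rewrite mxE imN; apply: cvgN.
Qed.

Lemma cvg_leR (f : T -> R) (l a : R) :
  f @ G --> l -> (\forall t \near G, f t <= a) -> l <= a.
Proof.
move=> h fa; rewrite -(cvg_lim _ h) //.
by apply: limr_le => //; apply: cvgP h.
Qed.

Lemma cvg_geR (f : T -> R) (l a : R) :
  f @ G --> l -> (\forall t \near G, a <= f t) -> a <= l.
Proof.
move=> h fa; rewrite -(cvg_lim _ h) //.
by apply: limr_ge => //; apply: cvgP h.
Qed.

Lemma cvg_entries_dot d (M : T -> 'M[F]_d) S (v : 'cV[F]_d) :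
  cvg_entries G M S -> (fun t => dot (M t *m v) v) @ G --> dot (S *m v) v.
Proof.
move=> h; rewrite dotE; under eq_fun do rewrite dotE.
apply: cvg_sumR => i.
have [a b] := cvg_entries_mul h (cvg_entries_cst v) i 0.
by apply: cvgD; apply: cvgMl.
Qed.

Lemma cvg_im_of (a b : T -> R) a0 b0 : b @ G --> b0 ->
  (fun t => im (of_re_im F (a t) (b t))) @ G --> im (of_re_im F a0 b0).
Proof. by move=> hb; case: hF => -> //=; exact: cvg_cst. Qed.

(** By polarization the entries of a hermitian matrix are fixed combinations of values of its form.
    This turns monotone convergence of real numbers into convergence of matrices. *)
Lemma cvg_entries_form d (M : T -> 'M[F]_d) (s : 'cV[F]_d -> R) :
  (forall t, adjoint (M t) = M t) ->
  (forall v, (fun t => dot (M t *m v) v) @ G --> s v) ->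
  cvg_entries G M (mx_of_form s).
Proof.
move=> h hs.
have hp u v : (fun t => polar (fun w => dot (M t *m w) w) u v) @ G --> polar s u v.
  by apply: cvgMr_tmp; apply: cvgB; [apply: cvgB|]; exact: hs.
move=> i j; rewrite mxE; split.
- rewrite re_of; under eq_fun do rewrite -(mx_of_formK (h _)) mxE re_of.
  exact: hp.
- under eq_fun do rewrite -(mx_of_formK (h _)) mxE.
  by apply: cvg_im_of; apply: cvgN; exact: hp.
Qed.

Lemma cvg_entries_unique m n (M : T -> 'M[F]_(m, n)) S U :
  cvg_entries G M S -> cvg_entries G M U -> S = U.
Proof.
move=> h h'; apply/matrixP => i j; have [a b] := h i j; have [a' b'] := h' i j.
by apply: re_im_inj; [exact: (cvg_unique _ a a')|exact: (cvg_unique _ b b')].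
Qed.

Lemma cvg_entries_adjoint m n (M : T -> 'M[F]_(m, n)) S :
  cvg_entries G M S -> cvg_entries G (fun t => adjoint (M t)) (adjoint S).
Proof.
move=> h i j; rewrite !mxE; split; rewrite ?re_conj ?im_conj.
  by under eq_fun do rewrite !mxE re_conj; have [] := h j i.
by under eq_fun do rewrite !mxE im_conj; apply: cvgN; have [] := h j i.
Qed.

Lemma cvg_entries_herm d (M : T -> 'M[F]_d) S :
  (forall t, adjoint (M t) = M t) -> cvg_entries G M S -> adjoint S = S.
Proof.
move=> hM h; apply: (cvg_entries_unique (cvg_entries_adjoint h)).
by rewrite (_ : (fun t => _) = M) //; apply/funext => t; rewrite hM.
Qed.

Lemma cvg_entriesP m n (M : T -> 'M[F]_(m, n)) (S : 'M[F]_(m, n)) :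
  M @ G --> S <-> cvg_entries G M S.
Proof.
split=> h.
  move=> i j.
  have hij e : 0 < e -> \forall t \near G, `|S i j - M t i j| < of_real F e.
    move=> e0; have e0' : 0 < of_real F e by rewrite -of_real0 of_real_lt.
    move/cvg_ballP: h => /(_ _ e0').
    by apply: filterS => t [_ /(_ i j)].
  split; apply/cvgrPdist_lt => e e0; apply: filterS (hij e e0) => t ht.
  - rewrite -reN -reD -(of_real_lt (F := F)).
    exact: le_lt_trans (norm_re _) ht.
  - rewrite -imN -imD -(of_real_lt (F := F)).
    exact: le_lt_trans (norm_im _) ht.
apply/cvg_ballP => e e0.
(* The radius is an element of [F]; being positive, it is real. *)
have eE : e = of_real F (re e).
  apply: re_im_inj; rewrite ?re_of_real // im_of_real.
  by have := ltW e0; rewrite ge0_re_im => /andP[_ /eqP].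
have e0R : 0 < re e by rewrite -of_real_lt of_real0 -eE.
have near1 i j : \forall t \near G, ball (S i j) e (M t i j).
  have [/cvgrPdist_lt a /cvgrPdist_lt b] := h i j.
  have e2 : 0 < re e / 2 by rewrite divr_gt0.
  near=> t; rewrite /ball /= -[S i j - M t i j]of_re_imK.
  have -> x y : of_re_im F x y = of_real F x + of_re_im F 0 1 * of_real F y.
    apply: re_im_inj; rewrite !(reD, imD, reM, imM) !re_of !im_of_real.
      by rewrite mul0r sub0r mulr0 oppr0 addr0.
    by case: hF => -> /=; rewrite !(mulr0, mul0r, mul1r, add0r).
  apply: le_lt_trans (ler_normD _ _) _; rewrite normrM !norm_of_real.
  (* This element is the imaginary unit over the complex field and 0 over the reals. *)
  have i1 : `|of_re_im F 0 1| <= 1.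
    rewrite -(@expr_le1 _ 2) // -normrX.
    by case: hF => -> /=; rewrite ?expr0n ?normr0 //= (_ : _ ^+ 2 = -1) ?normrN1 // sqr_i.
  apply: (@le_lt_trans _ _
    (of_real F (`|re (S i j - M t i j)| + `|im (S i j - M t i j)|))).
    by rewrite of_realD lerD2l ler_piMl // of_real_ge0.
  rewrite eE of_real_lt.
  rewrite reD reN imD imN [ltRHS]splitr ltrD //; near: t; [exact: a|exact: b].
have : \forall t \near G, forall i j, ball (S i j) e (M t i j).
  by apply: filter_forall => i; apply: filter_forall => j; exact: near1.
by apply: filterS => t ht; split.
Unshelve. all: by end_near. Qed.

Lemma cvg_entries_psd d (M : T -> 'M[F]_d) S :
  (forall t, psd (M t)) -> cvg_entries G M S -> psd S.
Proof.
move=> p h; apply/psdP; split.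
  by apply: cvg_entries_herm h => t; exact: psd_herm.
move=> v; apply: cvg_geR; first exact: cvg_entries_dot h.
by apply: nearW => t; exact: psd_ge0.
Qed.

End Polarization.

(** * Positive semidefinite square roots *)

Section SquareRoot.
Context {R : realType} {F : scalars R} {hF : real_or_complex F}.

(** A crude bound for the norm, polynomial in the entries so that its measurability in [M] is
    immediate. *)
Definition form_bound d (M : 'M[F]_d) : R :=
  \sum_i \sum_j 2 * (1 + re (M i j) ^+ 2 + im (M i j) ^+ 2).

Lemma form_bound_ge0 d (M : 'M[F]_d) : 0 <= form_bound M.
Proof.
rewrite sumr_ge0 // => i _; rewrite sumr_ge0 // => j _.
by rewrite mulr_ge0 // !addr_ge0 // sqr_ge0.
Qed.

Lemma form_boundP d (M : 'M[F]_d) v : dot (M *m v) v <= form_bound M * dot v v.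
Proof.
have comp i : re (v i 0) ^+ 2 + im (v i 0) ^+ 2 <= dot v v.
  rewrite dotE (bigD1 i) //= !expr2 lerDl sumr_ge0 // => k _.
  by rewrite addr_ge0 // -expr2 sqr_ge0.
rewrite dotE /form_bound mulr_suml ler_sum // => i _.
rewrite mxE re_sum im_sum !mulr_suml -big_split /= ler_sum // => j _.
rewrite reM imM.
have D0 := dot_ge0 v; move: (comp i) (comp j) D0.
move: (re (M i j)) (im (M i j)) (re (v i 0)) (im (v i 0)) (re (v j 0))
  (im (v j 0)) (dot v v) => x y a b c e D h1 h2 D0.
have := sqr_ge0 (c - a); have := sqr_ge0 (e - b); have := sqr_ge0 (c + a).
have := sqr_ge0 (e + b); have := sqr_ge0 (c - b); have := sqr_ge0 (e + a).
have := sqr_ge0 (c + b); have := sqr_ge0 (e - a) => g1 g2 g3 g4 g5 g6 g7 g8.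
have t1 : `|c * a + e * b| <= D by rewrite ler_norml; apply/andP; split; lra.
have t2 : `|c * b - e * a| <= D by rewrite ler_norml; apply/andP; split; lra.
have -> : (x * c - y * e) * a + (x * e + y * c) * b =
  x * (c * a + e * b) + y * (c * b - e * a) by ring.
have n1 : `|x| <= 1 + x ^+ 2 + y ^+ 2 by rewrite ler_norml; apply/andP; split; nra.
have n2 : `|y| <= 1 + x ^+ 2 + y ^+ 2 by rewrite ler_norml; apply/andP; split; nra.
apply: (le_trans (ler_norm _)); apply: (le_trans (ler_normD _ _)).
by rewrite !normrM -mulrA mulr_natl mulr2n lerD // ler_pM.
Qed.

Lemma loewner_le_form_bound d (M : 'M[F]_d) a : psd M -> form_bound M <= a ->
  psd ((of_real F a)%:M - M).
Proof.
move=> p le_a; apply: (loewner_leP _ _).2; rewrite ?adjoint_scalar ?psd_herm // => v.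
apply: (le_trans (form_boundP M v)).
by rewrite mul_scalar_mx dotZl ler_wpM2r ?dot_ge0.
Qed.

Lemma psd_trace_ge0 d (M : 'M[F]_d) : psd M -> 0 <= re (\tr M).
Proof.
move=> p; rewrite re_sum sumr_ge0 // => i _.
by rewrite -dot_delta psd_ge0.
Qed.

Lemma psd_trace0 d (M : 'M[F]_d) : psd M -> re (\tr M) = 0 -> M = 0.
Proof.
move=> p /eqP; rewrite re_sum psumr_eq0 => [/allP h|i _]; last first.
  by rewrite -dot_delta psd_ge0.
apply/matrixP => i j; have /h /= := mem_index_enum j.
rewrite -dot_delta => /eqP/(psd_dot0 p)/matrixP/(_ i 0).
by rewrite -colE !mxE.
Qed.

Lemma psd_sandwich0 d (S D : 'M[F]_d) : psd S -> adjoint D *m S *m D = 0 ->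
  S *m D = 0.
Proof.
move=> p z; apply/matrixP => i j.
have := psd_dot0 (u := D *m delta_mx j 0) p.
rewrite -[D in X in dot _ X]adjointK -dot_adjoint !mulmxA z mul0mx dot0l.
by move=> /(_ hF erefl); rewrite -colE => /matrixP/(_ i 0); rewrite !mxE.
Qed.

(* With [D = S - T], [S D + D T = 0] gives [tr (D S D) + tr (D T D) = 0], a sum
   of two nonnegative terms; so [S D = T D = 0] and [D ^ 2 = 0]. *)
Lemma psd_sqrt_unique d (S T : 'M[F]_d) :
  psd S -> psd T -> S *m S = T *m T -> S = T.
Proof.
move=> pS pT e; apply/eqP; rewrite -subr_eq0; apply/eqP; set D := S - T.
have hD : adjoint D = D by rewrite adjointD adjointN !psd_herm.
have h : S *m D + D *m T = 0.
  by rewrite mulmxBl mulmxBr e addrA addrNK subrr.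
have tr0 : re (\tr (D *m S *m D)) + re (\tr (D *m T *m D)) = 0.
  rewrite -reD [\tr (D *m T *m D)]mxtrace_mulC -linearD /=.
  by rewrite -!mulmxA -mulmxDr h mulmx0 mxtrace0 re0.
have pDS : psd (D *m S *m D) by rewrite -{1}hD; exact: psd_sandwich.
have pDT : psd (D *m T *m D) by rewrite -{1}hD; exact: psd_sandwich.
have /eqP := tr0; rewrite paddr_eq0 ?psd_trace_ge0 //.
case/andP => /eqP/(psd_trace0 pDS) zS /eqP/(psd_trace0 pDT) zT.
have SD : S *m D = 0 by apply: psd_sandwich0 => //; rewrite hD.
have TD : T *m D = 0 by apply: psd_sandwich0 => //; rewrite hD.
apply/matrixP => i j.
have : D *m delta_mx j (0 : 'I_1) = 0.
  apply: dot_eq0; rewrite dot_adjoint hD mulmxA {1}/D mulmxBl SD TD subrr mul0mx.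
  exact: dot0r.
by rewrite -colE => /matrixP/(_ i 0); rewrite !mxE.
Qed.

Fixpoint sqrt_iter n (Y : 'M[F]_n) (k : nat) : 'M[F]_n :=
  if k is m.+1 then
    of_real F 2^-1 *: (Y + sqrt_iter Y m *m sqrt_iter Y m) else 0.

Section Contraction.
Variables (d : nat) (Z : 'M[F]_d.+1).
Hypotheses (Z0 : psd Z) (Z1 : psd (1 - Z)).

(** The induction goes in steps of two: [Z ^+ k.+2] is the sandwich [Z * Z ^+ k * Z]. *)
Lemma psd_exp k : psd (Z ^+ k).
Proof.
have [n] := ubnP k; elim: n k => // n IH [|[|k]] kn; rewrite ?expr0 ?expr1 //.
  exact: psd1.
have := @psd_sandwich _ _ _ _ (Z ^+ k) Z (IH k _).
by rewrite psd_herm // !mulmxE -exprS -exprSr; apply; lia.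
Qed.

Lemma psd_exp_decr k : psd (Z ^+ k - Z ^+ k.+1).
Proof.
have [n] := ubnP k; elim: n k => // n IH [|[|k]] kn; rewrite ?expr0 ?expr1 //.
  (* [Z] and [1 - Z] commute, so the right-hand side is [Z (1 - Z) (Z + (1 - Z))]. *)
  have -> : Z - Z ^+ 2 = adjoint Z *m (1 - Z) *m Z + adjoint (1 - Z) *m Z *m (1 - Z).
    have c : (1 - Z) * Z = Z * (1 - Z) by rewrite mulrBl mulrBr mul1r mulr1.
    rewrite !psd_herm // !mulmxE -!mulrA c [(1 - Z) * (Z * _)]mulrBl mul1r.
    by rewrite [RHS]addrC subrK mulrBr mulr1 expr2.
  by apply: psdD; exact: psd_sandwich.
have := @psd_sandwich _ _ _ _ (Z ^+ k - Z ^+ k.+1) Z (IH k _).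
rewrite psd_herm // !mulmxE mulrBr mulrBl -!exprS -!exprSr; apply; lia.
Qed.

Lemma psd_exp_le1 k : psd (1 - Z ^+ k).
Proof.
elim: k => [|k IH]; first by rewrite expr0 subrr; exact: psd0.
by rewrite -(subrKA (Z ^+ k)); apply: psdD => //; exact: psd_exp_decr.
Qed.

(** The iterates approaching the square root are polynomials in [Z]; this reduces their positivity
    and monotonicity to signs of coefficients, and their upper bound to a value at 1. *)
Lemma psd_horner_mx (p : {poly F}) :
  p \is a polyOver (@Num.Def.nneg_num_pred F) -> psd (horner_mx Z p).
Proof.
move=> /polyOverP p0.
rewrite -[p in horner_mx Z p]coefK poly_def rmorph_sum /=; apply: psd_sum => i _.
rewrite linearZ /= rmorphXn /= horner_mx_X.
have pi : p`_i = of_real F (re p`_i).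
  have := p0 i; rewrite unfold_in ge0_re_im => /andP[_ /eqP pi].
  by apply: re_im_inj; rewrite ?re_of_real ?im_of_real.
rewrite pi; apply: psdZ; last exact: psd_exp.
by rewrite -(of_real_ge0 (F := F)) -pi; exact: p0.
Qed.

(** [1 - p(Z)] is the sum of [1 - p(1)] and of the matrices [1 - Z ^ i] weighted by the coefficients
    of [p]. *)
Lemma psd_horner_mx_le (p : {poly F}) :
  p \is a polyOver (@Num.Def.nneg_num_pred F) -> p.[1] <= 1 -> psd (1 - horner_mx Z p).
Proof.
move=> /polyOverP p0 p1.
have pi i : p`_i = of_real F (re p`_i).
  have := p0 i; rewrite unfold_in ge0_re_im => /andP[_ /eqP pi].
  by apply: re_im_inj; rewrite ?re_of_real ?im_of_real.
have pi0 i : 0 <= re p`_i by rewrite -(of_real_ge0 (F := F)) -pi; exact: p0.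
rewrite -(subrKA (p.[1])%:M); apply: psdD.
  have -> : 1 - p.[1]%:M = (1 - p.[1]) *: 1%:M :> 'M[F]_d.+1.
    by rewrite scalerBl scale1r scalemx1.
  have -> : 1 - p.[1] = of_real F (re (1 - p.[1])).
    move: p1; rewrite -subr_ge0 ge0_re_im => /andP[_ /eqP pi1].
    by apply: re_im_inj; rewrite ?re_of_real ?im_of_real.
  apply: psdZ (@psd1 _ _ _ _).
  by move: p1; rewrite -subr_ge0 ge0_re_im => /andP[].
rewrite -[p in horner_mx Z p]coefK poly_def rmorph_sum /= horner_coef.
rewrite -scalemx1 scaler_suml -sumrB; apply: psd_sum => i _.
rewrite expr1n mulr1 linearZ /= rmorphXn /= horner_mx_X -scalerBr pi.
by apply: psdZ => //; exact: psd_exp_le1.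
Qed.

(* The fixed point of Y |-> (Z + Y^2) / 2 is 1 - (1 - Z)^(1/2). *)
Fixpoint sqrt_poly (n : nat) : {poly F} :=
  if n is m.+1 then 2^-1 *: ('X + sqrt_poly m ^+ 2) else 0.

Let nneg2V : (2^-1 : F) \in @Num.Def.nneg_num_pred F.
Proof. by rewrite unfold_in invr_ge0. Qed.

Lemma sqrt_poly_nneg n : sqrt_poly n \is a polyOver (@Num.Def.nneg_num_pred F).
Proof.
elim: n => [|n IH] /=; first exact: rpred0.
by rewrite polyOverZ // rpredD ?polyOverX // rpredX.
Qed.

Lemma sqrt_poly_incr n :
  sqrt_poly n.+1 - sqrt_poly n \is a polyOver (@Num.Def.nneg_num_pred F).
Proof.
elim: n => [|n IH].
  rewrite /= subr0 expr0n addr0 polyOverZ ?polyOverX //.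
rewrite /= -scalerBr opprD addrACA subrr add0r subr_sqr polyOverZ //.
by apply: rpredM => //; apply: rpredD;
  [exact: (sqrt_poly_nneg n.+1)|exact: sqrt_poly_nneg].
Qed.

Lemma sqrt_poly1 n : (sqrt_poly n).[1] <= 1.
Proof.
elim: n => [|n IH] /=; first by rewrite horner0.
rewrite hornerZ hornerD hornerX horner_exp ler_pdivrMl // mulr1.
rewrite -[leRHS]/(1 + 1) lerD2l expr_le1 //.
have /polyOverP p0 := sqrt_poly_nneg n.
rewrite horner_coef sumr_ge0 // => i _; rewrite expr1n mulr1.
by have := p0 i; rewrite unfold_in.
Qed.

Lemma horner_sqrt_poly k : horner_mx Z (sqrt_poly k) = sqrt_iter Z k.
Proof.
elim: k => [|k IH] /=; first by rewrite rmorph0.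
rewrite linearZ /= rmorphD /= rmorphXn /= horner_mx_X IH expr2 -mulmxE.
congr (_ *: _); rewrite of_realV; congr (_^-1).
by rewrite -[2]/(1 + 1) of_realD of_real1.
Qed.

Lemma sqrt_iter_cvg : exists T, [/\ psd T, T *m T = 1%:M - Z &
  cvg_entries \oo (fun k => 1%:M - sqrt_iter Z k) T].
Proof.
have pY k : psd (sqrt_iter Z k).
  by rewrite -horner_sqrt_poly; apply: psd_horner_mx (sqrt_poly_nneg k).
have pY1 k : psd (1%:M - sqrt_iter Z k).
  rewrite -horner_sqrt_poly; apply: psd_horner_mx_le (sqrt_poly_nneg k) _.
  exact: sqrt_poly1.
have incr v : nondecreasing_seq (fun k => dot (sqrt_iter Z k *m v) v).
  apply/nondecreasing_seqP => k; rewrite -subr_ge0 -dotNl -dotDl -mulmxBl.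
  apply: psd_ge0; rewrite -!horner_sqrt_poly -rmorphB /=.
  exact: psd_horner_mx (sqrt_poly_incr k).
have cv v : cvgn (fun k => dot (sqrt_iter Z k *m v) v).
  apply: nondecreasing_is_cvgn => //; exists (dot v v) => _ [k _ <-].
  by rewrite -subr_ge0 -{1}(mul1mx v) -dotNl -dotDl -mulmxBl psd_ge0.
pose S : 'M[F]_d.+1 :=
  mx_of_form (fun v => limn (fun k => dot (sqrt_iter Z k *m v) v)).
have cvY : cvg_entries \oo (sqrt_iter Z) S.
  by apply: cvg_entries_form => // k; exact: psd_herm.
have cvT : cvg_entries \oo (fun k => 1%:M - sqrt_iter Z k) (1%:M - S).
  by apply: cvg_entriesD; [exact: cvg_entries_cst|exact: cvg_entriesN].
have fixS : S = of_real F 2^-1 *: (Z + S *m S).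
  apply: (@cvg_entries_unique _ _ _ _ \oo _ _ _ (fun k => sqrt_iter Z k.+1)).
    move=> i j; have [a b] := cvY i j.
    by split; rewrite (cvg_shiftS (fun k => _ (sqrt_iter Z k i j))).
  apply: cvg_entriesZ; apply: cvg_entriesD; first exact: cvg_entries_cst.
  exact: cvg_entries_mul.
exists (1%:M - S); split => //; first exact: cvg_entries_psd cvT.
have e : S + S = Z + S *m S.
  rewrite {1 2}fixS -scalerDl -of_realD -[_ + _]/(2^-1 + 2^-1).
  by rewrite (_ : 2^-1 + 2^-1 = 1 :> R) ?of_real1 ?scale1r //; lra.
have -> : Z = S + S - S *m S by rewrite e addrK.
by rewrite mulmxBl mul1mx mulmxBr mulmx1 !opprD !opprK !addrA.
Qed.

End Contraction.

(** [M / c] lies between 0 and 1, and the matrix in parentheses tends to its square root; the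
    summand 1 keeps [c] positive. An explicit sequence is given because the measurability of
    [psd_sqrt] is derived from it. *)
Definition sqrt_approx d (M : 'M[F]_d) (k : nat) : 'M[F]_d :=
  let c := 1 + form_bound M in
  of_real F (Num.sqrt c) *:
    (1%:M - sqrt_iter (1%:M - of_real F c^-1 *: M) k).

Lemma psd_sqrt_spec d (M : 'M[F]_d) : psd M ->
  [/\ psd (psd_sqrt M), psd_sqrt M *m psd_sqrt M = M &
      cvg_entries \oo (sqrt_approx M) (psd_sqrt M)].
Proof.
move=> pM.
suff [S [pS SM cS]] : exists S, [/\ psd S, S *m S = M &
    cvg_entries \oo (sqrt_approx M) S].
  have [p' e'] : psd (psd_sqrt M) /\ psd_sqrt M *m psd_sqrt M = M.
    rewrite /psd_sqrt; case: xgetP => [T _ //|/(_ S)[]].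
    by split.
  suff -> : psd_sqrt M = S by [].
  by apply: psd_sqrt_unique => //; rewrite e' SM.
(* The iteration uses the ring of square matrices, whose size is a successor; size 0 is treated
   apart. *)
case: d M pM => [|d] M pM.
  exists 0; split; first exact: psd0.
    by apply/matrixP => -[].
  by move=> -[].
set c := 1 + form_bound M.
have c0 : 0 < c by rewrite ltr_wpDr ?form_bound_ge0.
have p1 : psd (of_real F c^-1 *: M) by apply: psdZ => //; rewrite invr_ge0 ltW.
have p2 : psd (1%:M - of_real F c^-1 *: M).
  have -> : 1%:M - of_real F c^-1 *: M = of_real F c^-1 *: ((of_real F c)%:M - M).
    rewrite scalerBr scale_scalar_mx -of_realM mulVf ?gt_eqF //.
    by rewrite of_real1.
  apply: psdZ; first by rewrite invr_ge0 ltW.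
  by apply: loewner_le_form_bound => //; rewrite lerDr.
have [|T [pT TT cT]] := sqrt_iter_cvg p2.
  by rewrite subKr.
exists (of_real F (Num.sqrt c) *: T); split.
- by apply: psdZ => //; exact: sqrtr_ge0.
- rewrite -scalemxAl -scalemxAr scalerA -of_realM -expr2 sqr_sqrtr ?ltW //.
  by rewrite TT subKr scalerA -of_realM mulfV ?gt_eqF // of_real1 scale1r.
- exact: cvg_entriesZ.
Qed.

Lemma psd_sqrt_psd d (M : 'M[F]_d) : psd M -> psd (psd_sqrt M).
Proof. by move=> /psd_sqrt_spec[]. Qed.

Lemma psd_sqrtK d (M : 'M[F]_d) : psd M -> psd_sqrt M *m psd_sqrt M = M.
Proof. by move=> /psd_sqrt_spec[]. Qed.

Lemma dot_psd_sqrt d (M : 'M[F]_d) u v : psd M ->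
  dot (psd_sqrt M *m u) (psd_sqrt M *m v) = dot (M *m u) v.
Proof.
move=> p; rewrite -{3}(psd_sqrtK p) -mulmxA [RHS]dot_adjoint.
by rewrite psd_herm //; exact: psd_sqrt_psd.
Qed.

End SquareRoot.

(** * Interpolation at Chebyshev nodes *)

Section Interpolation.
Context {R : realType}.
Variable m : nat.
Let n := m.+1.

Let n0 : (n%:R : R) != 0. Proof. by rewrite pnatr_eq0. Qed.

(** The zeros of [cos (n psi)] in the interval from 0 to pi, where [sin (n psi)] is alternately 1
    and -1. *)
Definition node (k : nat) : R := (k.*2.+1)%:R * (pi / (n.*2)%:R).

Lemma nodeM k (j : nat) : j%:R * node k = (k.*2.+1)%:R * (j%:R * (pi / (n.*2)%:R)).
Proof. by rewrite /node mulrCA. Qed.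

Lemma node_bounds k : (k < n)%N -> 0 < node k < pi.
Proof.
move=> kn; have p0 := @pi_gt0 R; rewrite /node -(muln2 n) natrM.
have np : (0 : R) < n%:R by rewrite ltr0n.
have kl : (k.*2.+1)%:R < n%:R * 2 :> R by rewrite -natrM ltr_nat; lia.
have k0 : (0 : R) < (k.*2.+1)%:R by rewrite ltr0n.
have np2 : (0 : R) < n%:R * 2 by rewrite mulr_gt0.
rewrite mulrA; apply/andP; split; first by rewrite divr_gt0 // mulr_gt0.
by rewrite ltr_pdivrMr // mulrC ltr_pM2l.
Qed.

Lemma sin_nat_pi (j : nat) : sin (j%:R * pi) = 0 :> R.
Proof.
elim: j => [|j IH]; first by rewrite mul0r sin0.
by rewrite -natr1 mulrDl mul1r sinD IH sinpi mulr0 mul0r addr0.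
Qed.

Lemma sin_last_node k : sin (n%:R * node k) = (-1) ^+ k :> R.
Proof.
rewrite nodeM -(muln2 n) natrM.
have -> : n%:R * (pi / (n%:R * 2)) = pi / 2 :> R by field.
elim: k => [|k IH]; first by rewrite mul1r expr0 sin_pihalf.
rewrite doubleS -addn2 natrD mulrDl exprS -IH.
have -> : 2 * (pi / 2) = pi :> R by field.
by rewrite sinDpi mulN1r.
Qed.

Lemma cos_last_node k : cos (n%:R * node k) = 0 :> R.
Proof.
rewrite nodeM -(muln2 n) natrM.
have -> : n%:R * (pi / (n%:R * 2)) = pi / 2 :> R by field.
elim: k => [|k IH]; first by rewrite mul1r cos_pihalf.
rewrite doubleS -addn2 natrD mulrDl.
have -> : 2 * (pi / 2) = pi :> R by field.
by rewrite cosDpi IH oppr0.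
Qed.

(** Multiplied by [2 cos th], the sum telescopes to a multiple of [sin (j pi)]; [j < n] puts [th]
    below [pi / 2], so the factor is nonzero. *)
Lemma alternating_sum (j : nat) : (j < n)%N ->
  \sum_(k < n) (-1) ^+ k * sin (j%:R * node k) = 0 :> R.
Proof.
move=> jn; set th : R := j%:R * (pi / (n.*2)%:R).
have p0 := @pi_gt0 R.
have np2 : (0 : R) < (n.*2)%:R by rewrite ltr0n; lia.
have c0 : 0 < cos th.
  apply: cos_gt0_pihalf; apply/andP; split.
    apply: (@lt_le_trans _ _ 0); first by rewrite oppr_lt0 divr_gt0.
    by rewrite mulr_ge0 // divr_ge0 // ltW.
  rewrite /th -(muln2 n) natrM.
  have -> : j%:R * (pi / (n%:R * 2)) = j%:R / n%:R * (pi / 2) :> R by field.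
  rewrite gtr_pMl ?divr_gt0 //.
  by rewrite ltr_pdivrMr ?ltr0n // mul1r ltr_nat.
apply: (@mulfI _ (2 * cos th)); first by rewrite mulf_neq0 // gt_eqF.
rewrite mulr0 mulr_sumr.
pose g k : R := (-1) ^+ k * sin ((k.*2)%:R * th).
rewrite (eq_bigr (fun k : 'I_n => - (g k.+1 - g k))); last first.
  move=> k _; rewrite nodeM -/th /g doubleS.
  have -> : ((k.*2).+2%:R : R) * th = (k.*2.+1)%:R * th + th.
    by rewrite -[in LHS]natr1 mulrDl mul1r.
  have -> : ((k.*2)%:R : R) * th = (k.*2.+1)%:R * th - th.
    by rewrite -[(k.*2.+1)%:R]natr1 mulrDl mul1r addrK.
  by rewrite sinD sinB exprS; ring.
rewrite sumrN -(big_mkord xpredT (fun k => g k.+1 - g k)) telescope_sumr //.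
rewrite /g double0 mul0r sin0 mulr0 subr0.
have -> : ((n.*2)%:R : R) * th = j%:R * pi.
  by rewrite /th mulrCA [_%:R * (pi / _)]mulrC divfK // gt_eqF.
by rewrite sin_nat_pi mulr0 oppr0.
Qed.

(** Coefficients of the Riesz formula: the sum of [node_coef k * S (node k)] is the derivative at 0
    of a sine polynomial [S] of degree at most [n]. *)
Definition node_coef k : R := (-1) ^+ k / (2 * n%:R * sin (node k / 2) ^+ 2).

Lemma sin_half_node_gt0 k : (k < n)%N -> 0 < sin (node k / 2).
Proof.
move=> /node_bounds/andP[a b]; apply: sin_gt0_pi.
by apply/andP; split; lra.
Qed.

Definition sine_sum j : R := \sum_(k < n) node_coef k * sin (j%:R * node k).

(** The second difference in [j] of [sin (j psi)] is [-4 sin (psi / 2) ^ 2 sin ((j + 1) psi)], and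
    the square cancels the denominator of [node_coef]. *)
Lemma sine_sum_rec j : sine_sum j.+2 = 2 * sine_sum j.+1 - sine_sum j
  - 2 / n%:R * \sum_(k < n) (-1) ^+ k * sin (j.+1%:R * node k).
Proof.
rewrite /sine_sum !mulr_sumr -!sumrB; apply: eq_bigr => k _.
have s0 := sin_half_node_gt0 (ltn_ord k).
have -> : (j.+2%:R : R) * node k = j.+1%:R * node k + node k.
  by rewrite -[in LHS]natr1 mulrDl mul1r.
have -> : (j%:R : R) * node k = j.+1%:R * node k - node k.
  by rewrite -[j.+1%:R]natr1 mulrDl mul1r addrK.
rewrite sinD sinB.
have -> : cos (node k) = 1 - 2 * sin (node k / 2) ^+ 2.
  have e : node k = node k / 2 + node k / 2 by lra.
  rewrite {1}e cosD -!expr2.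
  by have := cos2Dsin2 (node k / 2); lra.
by rewrite /node_coef; field; rewrite n0 gt_eqF.
Qed.

(** The recurrence makes [sine_sum] linear up to [n]. The slope is read off one step further: as
    [cos (n psi)] vanishes at the nodes, [sine_sum] takes equal values at [n - 1] and [n + 1], and
    there the alternating sum is [n] instead of 0. *)
Lemma sine_sumE j : (j <= n)%N -> sine_sum j = j%:R.
Proof.
have s0 : sine_sum 0 = 0.
  by rewrite /sine_sum big1 // => k _; rewrite mul0r sin0 mulr0.
have lin i : (i < n)%N -> sine_sum i = i%:R * sine_sum 1 /\
    sine_sum i.+1 = i.+1%:R * sine_sum 1.
  elim: i => [|i IH] h; first by rewrite s0 mul0r mul1r.
  have [a b] := IH (ltnW h); split=> //.
  rewrite sine_sum_rec alternating_sum // mulr0 subr0 a b.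
  by rewrite -[i.+2]addn2 -[i.+1]addn1 !natrD; ring.
suff s1 : sine_sum 1 = 1.
  case: j => [_|j /lin[_ ->]]; first exact: s0.
  by rewrite s1 mulr1.
have := sine_sum_rec m; have [a b] := lin m (ltnSn m).
have -> : sine_sum m.+2 = sine_sum m.
  apply: eq_bigr => k _; congr (_ * _).
  have -> : (m.+2%:R : R) * node k = n%:R * node k + node k.
    by rewrite -[in LHS]natr1 mulrDl mul1r.
  have -> : (m%:R : R) * node k = n%:R * node k - node k.
    by rewrite -[n%:R]natr1 mulrDl mul1r addrK.
  by rewrite sinD sinB cos_last_node !mul0r addr0 subr0.
rewrite (eq_bigr (fun=> 1)) => [|k _]; last first.
  by rewrite sin_last_node -expr2 sqrr_sign.
rewrite sumr_const card_ord -/n mulfVK // a b -natr1.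
by lra.
Qed.

(** The right-hand side is the derivative at 0 of [cos psi ^ p * sin (j psi)]. The product formula
    trades a cosine for a shift of [j] by one, whence the condition on [j + p]. *)
Lemma node_moment p j : (j + p <= n)%N ->
  \sum_(k < n) node_coef k * (cos (node k) ^+ p * sin (j%:R * node k)) = j%:R.
Proof.
elim: p j => [|p IH] j jp.
  rewrite addn0 in jp; rewrite -[RHS](sine_sumE jp).
  by apply: eq_bigr => k _; rewrite expr0 mul1r.
case: j jp => [|j] jp.
  by rewrite big1 // => k _; rewrite mul0r sin0 !mulr0.
have h1 := IH j.+2 ltac:(lia); have h2 := IH j ltac:(lia).
apply: (@mulfI _ 2) => //.
have -> : 2 * j.+1%:R = j.+2%:R + j%:R :> R.
  by rewrite -[j.+2]addn2 -[j.+1]addn1 !natrD; ring.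
rewrite -h1 -h2 -big_split mulr_sumr; apply: eq_bigr => k _ /=.
have -> : (j.+2%:R : R) * node k = j.+1%:R * node k + node k.
  by rewrite -[in LHS]natr1 mulrDl mul1r.
have -> : (j%:R : R) * node k = j.+1%:R * node k - node k.
  by rewrite -[j.+1%:R]natr1 mulrDl mul1r addrK.
by rewrite sinD sinB exprS; ring.
Qed.

(** The signs of the coefficients are those of [sin (n psi)] at the nodes, so this is the Riesz
    formula for that function. *)
Lemma sum_norm_node_coef : \sum_(k < n) `|node_coef k| = n%:R.
Proof.
rewrite -[RHS](sine_sumE (leqnn n)); apply: eq_bigr => k _.
rewrite sin_last_node /node_coef [RHS]mulrAC -expr2 sqrr_sign mul1r.
rewrite normrM normrX normrN1 expr1n mul1r gtr0_norm //.
have s0 := sin_half_node_gt0 (ltn_ord k).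
by rewrite invr_gt0 mulr_gt0 ?exprn_gt0 // mulr_gt0 ?ltr0n.
Qed.

Lemma node_quadrature (q : {poly R}) : (size q <= n)%N ->
  \sum_(k < n) node_coef k * sin (node k) * q.[cos (node k)] = q.[1].
Proof.
move=> sq; rewrite (horner_coef_wide _ sq).
under eq_bigr => k _ do rewrite (horner_coef_wide _ sq) mulr_sumr.
rewrite exchange_big; apply: eq_bigr => i _ /=.
rewrite expr1n mulr1 -[RHS]mulr1 -[1 in RHS](@node_moment i 1) ?mulr_sumr //.
by apply: eq_bigr => k _; rewrite mul1r; ring.
Qed.

End Interpolation.

(* Riesz interpolation formula; the substitution [t = (1 + cos psi) / 2] turns
   [q (t) * sqrt (t * (1 - t))] into a sine polynomial of [psi]. *)
Lemma interpolation (R : realType) (n : nat) :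
  exists t b al : 'I_n -> R,
    [/\ forall k, 0 < t k < 1, forall k, 0 < al k, \sum_k al k = 2 * n%:R,
        forall k, b k ^+ 2 = al k ^+ 2 * (t k * (1 - t k)) &
        forall i, (i < n)%N -> \sum_k b k * t k ^+ i = 1].
Proof.
case: n => [|m].
  exists (fun=> 0), (fun=> 0), (fun=> 0).
  by split=> // [[]|[]||[]] //; rewrite big_ord0 mulr0.
(* Here [t (1 - t)] is a quarter of [sin psi ^ 2], which explains the factor 2 in the third
   witness. *)
exists (fun k => (1 + cos (node m k)) / 2).
exists (fun k => node_coef m k * sin (node m k)).
exists (fun k => 2 * `|@node_coef R m k|).
have sg (k : 'I_m.+1) : 0 < sin (node m k) :> R.
  exact/sin_gt0_pi/node_bounds.
split=> [k|k||k|i im].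
- have := @cos2Dsin2 R (node m k); have := sg k.
  set s := sin _; set c := cos _ => s0 h.
  have s2 : 0 < s ^+ 2 by rewrite exprn_gt0.
  have : `|c| < 1 by rewrite -(@expr_lt1 _ 2) // real_normK ?num_real //; lra.
  by rewrite ltr_norml => /andP[a b]; apply/andP; split; lra.
- rewrite mulr_gt0 // normr_gt0 /node_coef mulf_neq0 ?signr_eq0 // invr_neq0 //.
  have s0 := @sin_half_node_gt0 R m k (ltn_ord k).
  by rewrite gt_eqF // mulr_gt0 ?exprn_gt0 // mulr_gt0 ?ltr0n.
- by rewrite -mulr_sumr sum_norm_node_coef.
- move: (@node_coef R m k) => a; rewrite !exprMn real_normK ?num_real //.
  have := @cos2Dsin2 R (node m k).
  set s := sin _; set c := cos _ => h.
  have -> : s ^+ 2 = 1 - c ^+ 2 by lra.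
  by field.
- have /node_quadrature : (size ((2^-1 *: (1 + 'X)) ^+ i : {poly R}) <= m.+1)%N.
    apply: leq_trans (size_exp_leq _ _) _.
    suff : ((size (2^-1 *: (1 + 'X) : {poly R})).-1 <= 1)%N by nia.
    rewrite -subn1 leq_subLR; apply: leq_trans (size_scale_leq _ _) _.
    by rewrite addrC -polyC1 size_XaddC.
  rewrite horner_exp hornerZ hornerD hornerX hornerC -[1 + 1]/2.
  rewrite mulVf ?pnatr_eq0 // expr1n => e; rewrite -[RHS]e.
  apply: eq_bigr => k _.
  by rewrite horner_exp hornerZ hornerD hornerX hornerC [_ / 2]mulrC.
Qed.

(** * Determinants and extrapolation *)

Section Determinant.
Context {R : realType} {F : scalars R} {hF : real_or_complex F}.

Definition schur d (M : 'M[F]_(1 + d)) : 'M[F]_d :=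
  drsubmx M - (M 0 0)^-1 *: (dlsubmx M *m ursubmx M).

Lemma ulsubmx11 d (M : 'M[F]_(1 + d)) : ulsubmx M = (M 0 0)%:M.
Proof.
by rewrite [ulsubmx M]mx11_scalar !mxE; congr (M _ _)%:M; apply/val_inj.
Qed.

Lemma det_schur d (M : 'M[F]_(1 + d)) : M 0 0 != 0 ->
  \det M = M 0 0 * \det (schur M).
Proof.
move=> a0.
have e : M = block_mx 1%:M 0 ((M 0 0)^-1 *: dlsubmx M) 1%:M *m
              block_mx (M 0 0)%:M (ursubmx M) 0 (schur M).
  rewrite mulmx_block !mul1mx !mul0mx !addr0 -[LHS]submxK ulsubmx11.
  rewrite -!scalemxAl mul_mx_scalar scalerA mulVf // scale1r.
  by rewrite /schur addrCA subrr addr0.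
by rewrite {1}e det_mulmx det_lblock !det1 !mul1r det_ublock det_scalar1.
Qed.

Lemma dot_col_mx m n (u1 v1 : 'cV[F]_m) (u2 v2 : 'cV[F]_n) :
  dot (col_mx u1 u2) (col_mx v1 v2) = dot u1 v1 + dot u2 v2.
Proof.
rewrite /dot !innerE /adjoint map_col_mx tr_col_mx mul_row_col mxE reD //.
Qed.

(** For positive semidefinite [M] this is the vector with lower block [w] at which the form is
    least. *)
Lemma schur_vec d (M : 'M[F]_(1 + d)) (w : 'cV[F]_d) : M 0 0 != 0 ->
  M *m col_mx (- (M 0 0)^-1 *: (ursubmx M *m w)) w = col_mx 0 (schur M *m w).
Proof.
move=> a0; rewrite -{1}[M]submxK mul_block_col ulsubmx11 mul_scalar_mx.
rewrite scalerA mulrN mulfV // scaleN1r addNr; congr col_mx.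
by rewrite /schur mulmxBl scaleNr mulmxN -scalemxAr -scalemxAl mulmxA addrC.
Qed.

Lemma herm_schur d (M : 'M[F]_(1 + d)) : adjoint M = M ->
  adjoint (schur M) = schur M.
Proof.
move=> h; have e i j : conj (M i j) = M j i by rewrite -{2}h !mxE.
have c : conj (M 0 0)^-1 = (M 0 0)^-1.
  have -> : M 0 0 = of_real F (re (M 0 0)).
    apply: re_im_inj; rewrite ?re_of_real ?im_of_real //.
    by have := congr1 (@im _ F) (e 0 0); rewrite im_conj => z; lra.
  by rewrite -of_realV conj_of_real.
apply/matrixP => i j; rewrite !mxE !big_ord1 !mxE conjD e; congr (_ + _).
have cN (z : F) : conj (- z) = - conj z.
  by apply: re_im_inj; rewrite ?(re_conj, im_conj, reN, imN).
by rewrite cN !conjM c !e [X in _ * X]mulrC.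
Qed.

Lemma psd_schur d (M : 'M[F]_(1 + d)) : psd M -> M 0 0 != 0 -> psd (schur M).
Proof.
move=> p a0; apply/psdP; split; first exact/herm_schur/psd_herm.
move=> w; have := @psd_ge0 _ _ hF _ _ (col_mx (- (M 0 0)^-1 *: (ursubmx M *m w)) w) p.
by rewrite schur_vec // dot_col_mx dot0l add0r.
Qed.

Lemma schur_le d (N P : 'M[F]_(1 + d)) : psd N -> psd P ->
  N 0 0 != 0 -> P 0 0 != 0 ->
  (forall v, dot (N *m v) v <= dot (P *m v) v) ->
  forall w, dot (schur N *m w) w <= dot (schur P *m w) w.
Proof.
move=> pN pP n0 p0 NP w.
set uN := col_mx (- (N 0 0)^-1 *: (ursubmx N *m w)) w.
set uP := col_mx (- (P 0 0)^-1 *: (ursubmx P *m w)) w.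
have <- : dot (P *m uP) uP = dot (schur P *m w) w.
  by rewrite schur_vec // dot_col_mx dot0l add0r.
have <- : dot (N *m uN) uN = dot (schur N *m w) w.
  by rewrite schur_vec // dot_col_mx dot0l add0r.
apply: le_trans (NP uP).
have -> : uP = of_real F 1 *: uN + of_real F 1 *: (uP - uN).
  by rewrite of_real1 !scale1r addrC subrK.
rewrite psd_form_expand ?psd_herm // expr1n !mul1r.
(* [N uN] has only a lower block and [uP - uN] only an upper one; hence [uN] minimizes the form of
   [N] among the vectors with lower block [w]. *)
have -> : dot (N *m uN) (uP - uN) = 0.
  rewrite schur_vec // dotDr dotNr /uP /uN !dot_col_mx !dot0l !add0r.
  by rewrite subrr.
by rewrite mulr0 addr0 lerDl psd_ge0.
Qed.

Lemma psd_diag d (M : 'M[F]_d) i : psd M ->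
  M i i = of_real F (re (M i i)) /\ 0 <= re (M i i).
Proof.
move=> p; split; last by rewrite -dot_delta psd_ge0.
apply: re_im_inj; rewrite ?re_of_real ?im_of_real //.
have := congr1 (fun B : 'M[F]_d => im (B i i)) (psd_herm p).
by rewrite !mxE im_conj => e; lra.
Qed.

Lemma psd_det0 d (M : 'M[F]_(1 + d)) : psd M -> M 0 0 = 0 -> \det M = 0.
Proof.
move=> p z; have : dot (M *m delta_mx 0 0) (delta_mx 0 0) = 0.
  by rewrite dot_delta z re0.
move=> /(psd_dot0 p); rewrite -colE => c0.
rewrite (expand_det_col M 0) big1 // => i _.
by have /matrixP/(_ i 0) := c0; rewrite !mxE => ->; rewrite mul0r.
Qed.

(* Induction on [d]: the form of a Schur complement is a minimum of the original
   form, hence is monotone in the matrix. *)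
Lemma det_le d (N P : 'M[F]_d) : psd N -> psd P ->
  (forall v, dot (N *m v) v <= dot (P *m v) v) -> 0 <= \det N <= \det P.
Proof.
elim: d N P => [|d IH] N P pN pP NP; first by rewrite !det_mx00 ler01 lexx.
change 'M[F]_(1 + d) in N; change 'M[F]_(1 + d) in P.
have [eN n0] := psd_diag 0 pN; have [eP p0] := psd_diag 0 pP.
have np : re (N 0 0) <= re (P 0 0) by rewrite -!dot_delta.
have [Pz|Pz] := eqVneq (P 0 0) 0.
  rewrite (psd_det0 pP Pz) (psd_det0 pN) ?lexx //.
  rewrite eN; apply/eqP; rewrite of_real_eq0 eq_le n0 andbT.
  by rewrite (le_trans np) // Pz re0.
have sP := psd_schur pP Pz.
have /andP[dP _] := IH _ _ sP sP (fun=> lexx _).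
rewrite (det_schur Pz).
have [Nz|Nz] := eqVneq (N 0 0) 0.
  by rewrite (psd_det0 pN Nz) lexx mulr_ge0 // eP of_real_ge0.
have sN := psd_schur pN Nz.
have /andP[dN dNP] := IH _ _ sN sP (schur_le pN pP Nz Pz NP).
have N00 : 0 <= N 0 0 by rewrite eN of_real_ge0.
rewrite (det_schur Nz) (mulr_ge0 N00 dN) /=; apply: ler_pM => //.
by rewrite eN eP of_real_le.
Qed.

Lemma herm_unitmx d (U : 'M[F]_d) (e : R) : adjoint U = U -> 0 < e ->
  (forall v, e * dot v v <= dot (U *m v) v) -> U \in unitmx.
Proof.
move=> h e0 le_U; rewrite unitmxE unitfE; apply/det0P => -[v v0 vU].
case/eqP: v0; rewrite -[v]adjointK.
suff -> : adjoint v = 0 by rewrite adjoint0.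
apply: dot_eq0; apply/eqP; rewrite eq_le dot_ge0 andbT.
rewrite -(ler_pM2l e0) mulr0; apply: le_trans (le_U _) _.
by rewrite -{1}h -adjointM vU adjoint0 dot0l.
Qed.

End Determinant.

Section Extrapolation.
Context {R : realType} {F : scalars R} {hF : real_or_complex F}.

Lemma size_det_le (S : comNzRingType) n (Q : 'M[{poly S}]_n) :
  (forall i j, (size (Q i j) <= 2)%N) -> (size (\det Q) <= n.+1)%N.
Proof.
move=> h; apply: leq_trans (size_sum _ _ _) _; apply/bigmax_leqP => s _.
apply: (@leq_trans (size (\prod_i Q i (s i)))).
  by case: (odd_perm s); rewrite ?expr1 ?expr0 ?mul1r ?mulN1r ?size_polyN.
apply: leq_trans (size_prod_leq _ _) _; rewrite card_ord.
rewrite leq_subLR addnS ltnS addnn -muln2.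
rewrite -[X in (_ <= X * _)%N]card_ord -sum_nat_const.
exact: leq_sum.
Qed.

Lemma size_adj_le (S : comNzRingType) n (Q : 'M[{poly S}]_n) i j :
  (forall i j, (size (Q i j) <= 2)%N) -> (size ((\adj Q) i j) <= n)%N.
Proof.
case: n Q i j => [|n] Q i j h; first by case: i.
rewrite mxE /cofactor.
apply: (@leq_trans (size (\det (row' j (col' i Q))))).
  rewrite -signr_odd; case: (odd _).
    by rewrite expr1 mulN1r size_polyN.
  by rewrite expr0 mul1r.
by apply: size_det_le => k l; rewrite !mxE.
Qed.

Lemma extrapolate_poly n (t b : 'I_n -> R) (q : {poly F}) :
  (forall i, (i < n)%N -> \sum_k b k * t k ^+ i = 1) -> (size q <= n)%N ->
  q.[1] = \sum_k of_real F (b k) * q.[of_real F (t k)].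
Proof.
move=> mom sq; rewrite (horner_coef_wide _ sq).
under [RHS]eq_bigr => k _ do rewrite (horner_coef_wide _ sq) mulr_sumr.
rewrite exchange_big; apply: eq_bigr => i _ /=.
rewrite expr1n -(of_real1 (F := F)) -(mom i (ltn_ord i)) of_real_sum mulr_sumr.
by apply: eq_bigr => k _; rewrite of_realM of_realX; ring.
Qed.

Definition segment_mx d (P M : 'M[F]_d) (t : R) : 'M[F]_d :=
  of_real F t *: P + of_real F (1 - t) *: M.

(** Along the segment the entries are affine in the parameter, so the cofactors have degree less
    than [d], which is the range of the moment conditions. *)
Lemma adj_extrapolate d (t b : 'I_d -> R) (P M : 'M[F]_d) :
  (forall i, (i < d)%N -> \sum_k b k * t k ^+ i = 1) ->
  \adj P = \sum_k of_real F (b k) *: \adj (segment_mx P M (t k)).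
Proof.
move=> mom.
pose Q : 'M[{poly F}]_d := \matrix_(i, j) (P i j *: 'X + M i j *: (1 - 'X)).
have ev s : map_mx (horner_eval s) Q = s *: P + (1 - s) *: M.
  by apply/matrixP => i j; rewrite !mxE /horner_eval !hornerE; ring.
have sQ i j : (size (Q i j) <= 2)%N.
  rewrite mxE; apply: leq_trans (size_polyD _ _) _; rewrite geq_max.
  apply/andP; split; apply: leq_trans (size_scale_leq _ _) _.
    by rewrite size_polyX.
  by rewrite -opprB size_polyN size_XsubC.
have evP : map_mx (horner_eval 1) Q = P by rewrite ev scale1r subrr scale0r addr0.
apply/matrixP => i j; rewrite -{1}evP -map_mx_adj mxE /horner_eval.
rewrite [LHS](extrapolate_poly mom (size_adj_le i j sQ)) summxE.
apply: eq_bigr => k _; rewrite [RHS]mxE; congr (_ * _).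
have -> : segment_mx P M (t k) = map_mx (horner_eval (of_real F (t k))) Q.
  by rewrite ev /segment_mx of_realD of_realN of_real1.
by rewrite -map_mx_adj [RHS]mxE.
Qed.

(* The adjugate of [t P + (1 - t) M] is a polynomial in [t] of degree less than
   [d], and its determinant is at most that of [P] because [M <= P]. *)
Lemma inv_extrapolate d (t b : 'I_d -> R) (P M : 'M[F]_d) :
  (forall i, (i < d)%N -> \sum_k b k * t k ^+ i = 1) ->
  (forall k, 0 <= t k <= 1) ->
  psd P -> psd M -> (forall v, dot (M *m v) v <= dot (P *m v) v) ->
  P \in unitmx -> (forall k, segment_mx P M (t k) \in unitmx) ->
  exists be : 'I_d -> R, (forall k, `|be k| <= `|b k|) /\
    invmx P = \sum_k of_real F (be k) *: invmx (segment_mx P M (t k)).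
Proof.
move=> mom t01 pP pM MP uP uU.
have pU k : psd (segment_mx P M (t k)).
  by have /andP[a c] := t01 k; apply: psdD; apply: psdZ => //; lra.
have UP k v : dot (segment_mx P M (t k) *m v) v <= dot (P *m v) v.
  have /andP[a c] := t01 k; have := MP v.
  rewrite mulmxDl dotDl -!scalemxAl !dotZl => h; nra.
have dP0 : \det P != 0 by move: uP; rewrite unitmxE unitfE.
pose rho k := \det (segment_mx P M (t k)) / \det P.
have rho01 k : 0 <= rho k <= 1.
  have /andP[a c] := @det_le _ _ hF _ _ _ (pU k) pP (UP k).
  have dP : 0 < \det P by rewrite lt_def dP0 (le_trans a).
  by rewrite /rho divr_ge0 ?(ltW dP) //= ler_pdivrMr // mul1r.
have rhoE k : rho k = of_real F (re (rho k)).
  have /andP[] := rho01 k; rewrite ge0_re_im => /andP[_ /eqP z] _.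
  by apply: re_im_inj; rewrite ?re_of_real ?im_of_real.
exists (fun k => b k * re (rho k)); split=> [k|].
  have := rho01 k; rewrite rhoE of_real_ge0 -(of_real1 (F := F)) of_real_le.
  rewrite re_of_real => /andP[a c].
  by rewrite normrM ler_piMr // ger0_norm.
rewrite /invmx uP (adj_extrapolate P M mom) scaler_sumr.
apply: eq_bigr => k _; rewrite uU of_realM -rhoE !scalerA; congr (_ *: _).
rewrite /rho; field; rewrite dP0 andbT.
by have := uU k; rewrite unitmxE unitfE.
Qed.

End Extrapolation.

(** * The Bellman argument *)

Lemma ler_addeps (R : realFieldType) (a b c : R) : 0 <= c ->
  (forall e, 0 < e -> a <= b + e * c) -> a <= b.
Proof.
move=> c0 h; apply/ler_addgt0Pr => e e0.
have c1 : 0 < c + 1 by rewrite ltr_wpDl.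
apply: le_trans (h (e / (c + 1)) _) _; first by rewrite divr_gt0.
rewrite lerD2l mulrAC ler_pdivrMr // ler_pM2l //; lra.
Qed.

Section Carleson.
Context {R : realType} {F : scalars R} {hF : real_or_complex F}.
Variables (X : Type) (d : nat).

(* [mu], [hI], [WI] and [psi] stand for the integrals of 1, h, W and psi. *)
Variables (mu : set X -> R) (hI : set X -> 'cV[F]_d) (WI : set X -> 'M[F]_d)
  (psi : set X -> R) (good : set X -> Prop).
Hypothesis good_setD : forall E I, good E -> good I -> good (E `\` I).
Hypothesis mu_split : forall E I, good E -> good I -> I `<=` E ->
  mu E = mu I + mu (E `\` I).
Hypothesis hI_split : forall E I, good E -> good I -> I `<=` E ->
  hI E = hI I + hI (E `\` I).
Hypothesis WI_split : forall E I, good E -> good I -> I `<=` E ->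
  WI E = WI I + WI (E `\` I).
Hypothesis psi_split : forall E I, good E -> good I -> I `<=` E ->
  psi E = psi I + psi (E `\` I).
Hypothesis mu_ge0 : forall E, 0 <= mu E.
Hypothesis psi_ge0 : forall E, 0 <= psi E.
Hypothesis WI_psd : forall E, good E -> psd (WI E).
Hypothesis hI_le : forall E v, good E ->
  2 * dot (hI E) v <= psi E + dot (WI E *m v) v.

Variables (T : eqType) (S : T -> set X) (K : T -> 'M[F]_d).
Hypothesis K_psd : forall I, psd (K I).

Definition mass_in (L : seq T) (E : set X) : 'M[F]_d :=
  \sum_(J <- L | `[< S J `<=` E >]) K J.

(** Each [M J] collects [K] over the tail of the list that starts at [J]. Ordering by the list, not
    by inclusion, allows one set to occur with several ranks. *)
Fixpoint mass_consistent (M : T -> 'M[F]_d) (L : seq T) : Prop :=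
  if L is J :: L' then mass_in L (S J) = M J /\ mass_consistent M L' else True.

Definition nested (I J : T) : bool :=
  `[< S J `<=` S I \/ S J `&` S I = set0 >].

Section Weight.
Variables (c e : R).
Hypotheses (c0 : 0 < c) (e0 : 0 < e).

(** The integral of [c (W + e)]. Integrals, unlike averages, are additive, and [<U^-1 h, h>] formed
    from integrals is the one formed from averages times the measure. *)
Definition reg_weight (E : set X) : 'M[F]_d :=
  of_real F c *: (WI E + (of_real F (e * mu E))%:M).

Lemma reg_weight_split E I : good E -> good I -> I `<=` E ->
  reg_weight E = reg_weight I + reg_weight (E `\` I).
Proof.
move=> gE gI IE; rewrite /reg_weight -scalerDr (WI_split gE gI IE).
rewrite (mu_split gE gI IE) mulrDr of_realD; congr (_ *: _).
by rewrite addrACA -raddfD.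
Qed.

Lemma dot_reg_weight E v :
  dot (reg_weight E *m v) v = c * (dot (WI E *m v) v + e * mu E * dot v v).
Proof.
by rewrite -scalemxAl dotZl mulmxDl dotDl mul_scalar_mx dotZl.
Qed.

Lemma psd_reg_weight E : good E -> psd (reg_weight E).
Proof.
move=> gE; apply: psdZ; first exact: ltW.
apply: psdD; first exact: WI_psd.
rewrite -scalemx1; apply: psdZ; first by rewrite mulr_ge0 // ltW.
exact: psd1.
Qed.

(* Superadditivity of the Bellman function [<U_E^-1 h_E, h_E>], in the variational
   form [<U^-1 x, x> = max_v (2 <x, v> - <U v, v>)]; the list is sorted from the
   coarsest set to the finest one. *)
Lemma bellman (t : R) (vec : T -> 'cV[F]_d) (M : T -> 'M[F]_d) (L : seq T) :
  0 < t <= 1 -> (forall I, I \in L -> good (S I) /\ S I !=set0) ->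
  mass_consistent M L -> pairwise nested L ->
  (forall I, I \in L -> segment_mx (reg_weight (S I)) (M I) t *m vec I = hI (S I)) ->
  forall E v, good E ->
  (forall J, J \in L -> S J `<=` E \/ S J `&` E = set0) ->
  2 * dot (hI E) v - t * dot (reg_weight E *m v) v
  - (1 - t) * (\sum_(J <- L | `[< S J `<=` E >]) dot (K J *m v) v)
  + (1 - t) * (\sum_(J <- L | `[< S J `<=` E >]) dot (K J *m vec J) (vec J))
  <= psi E / (t * c).
Proof.
move=> /andP[t0 t1]; elim: L => [|I L IH] gL con nes sol E v gE adm.
  rewrite !big_nil !mulr0 subr0 addr0 dot_reg_weight.
  rewrite ler_pdivlMr ?mulr_gt0 //.
  (* With no sets left, the claim is the domination of [h] tested on [t c v]; the regularization
     only lowers the left-hand side. *)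
  have := hI_le (of_real F (t * c) *: v) gE.
  rewrite dotZr -scalemxAr dotZl dotZr => h.
  have h' : 0 <= e * mu E * dot v v by rewrite !mulr_ge0 ?dot_ge0 // ltW.
  have tc : 0 < t * c by rewrite mulr_gt0.
  have := mulr_ge0 (sqr_ge0 (t * c)) h'.
  move: h; set a := dot (hI E) v; set w := dot (WI E *m v) v.
  set z := e * mu E * dot v v => h h2.
  have -> : (2 * a - t * (c * (w + z))) * (t * c) =
    2 * (t * c * a) - t * c * (t * c * w) - (t * c) ^+ 2 * z by ring.
  by lra.
have [gI [x0 Ix0]] := gL I (mem_head _ _).
move: nes; rewrite pairwise_cons => /andP[/allP nI nes].
case: con => MI con.
have gL' J : J \in L -> good (S J) /\ S J !=set0.
  by move=> JL; apply: gL; rewrite inE JL orbT.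
have sol' J : J \in L -> segment_mx (reg_weight (S J)) (M J) t *m vec J = hI (S J).
  by move=> JL; apply: sol; rewrite inE JL orbT.
have adm' J : J \in L -> S J `<=` E \/ S J `&` E = set0.
  by move=> JL; apply: adm; rewrite inE JL orbT.
have {}IH := IH gL' con nes sol'.
have nI' J : J \in L -> S J `<=` S I \/ S J `&` S I = set0.
  by move=> /nI/asboolP.
have [IE|IE] := adm I (mem_head _ _); last first.
  rewrite !big_cons; case: ifPn => [/asboolP h|_]; last exact: IH.
  by exfalso; have : (S I `&` E) x0 by [split=> //; apply: h]; rewrite IE.
set E' := E `\` S I.
have gE' : good E' by exact: good_setD.
have split (f : T -> R) : \sum_(J <- L | `[< S J `<=` E >]) f J =
    \sum_(J <- L | `[< S J `<=` S I >]) f J + \sum_(J <- L | `[< S J `<=` E' >]) f J.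
  rewrite big_mkcond [in RHS]big_mkcond [X in _ = _ + X]big_mkcond -big_split.
  rewrite big_seq [RHS]big_seq; apply: eq_bigr => J JL /=.
  have [_ [y Jy]] := gL' J JL.
  case: (nI' J JL) => [JI|JI].
    have -> : `[< S J `<=` S I >] = true by apply/asboolP.
    have -> : `[< S J `<=` E >] = true by apply/asboolP; exact: subset_trans IE.
    have -> : `[< S J `<=` E' >] = false.
      by apply/asboolP => /(_ _ Jy)[_]; apply; exact: JI.
    by rewrite addr0.
  have -> : `[< S J `<=` S I >] = false.
    apply/asboolP => h; have : (S J `&` S I) y by split=> //; exact: h.
    by rewrite JI.
  rewrite add0r; congr (if _ then _ else _); apply: asbool_equiv_eq; split.
    move=> JE y' Jy'; split; first exact: JE.
    by move=> Iy'; have : (S J `&` S I) y' by []; rewrite JI.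
  by move=> JE y' /JE[].
(* Inside [S I] the tail is applied with the optimal vector [vec I]; on the rest of [E] the vector
   [v] is kept. *)
have h1 := IH (S I) (vec I) gI nI'.
have h2 : 2 * dot (hI E') v - t * dot (reg_weight E' *m v) v
  - (1 - t) * (\sum_(J <- L | `[< S J `<=` E' >]) dot (K J *m v) v)
  + (1 - t) * (\sum_(J <- L | `[< S J `<=` E' >]) dot (K J *m vec J) (vec J))
  <= psi E' / (t * c).
  apply: IH => // J JL.
  case: (nI' J JL) => [JI|JI].
    right; rewrite -subset0 => y [Jy [_]]; apply; exact: JI.
  case: (adm' J JL) => [JE|JE].
    left=> y Jy; split; first exact: JE.
    by move=> Iy; have : (S J `&` S I) y by []; rewrite JI.
  by right; rewrite -subset0 => y [Jy [Ey _]]; rewrite -JE.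
have EI : `[< S I `<=` E >] = true by apply/asboolP.
have II : `[< S I `<=` S I >] = true by apply/asboolP.
rewrite !big_cons EI !split (hI_split gE gI IE) (psi_split gE gI IE).
rewrite (reg_weight_split gE gI IE) -/E' mulmxDl !dotDl [(_ + _) / _]mulrDl.
have solI := sol I (mem_head _ _).
have pM : psd (M I) by rewrite -MI; apply: psd_sum.
have pU : psd (segment_mx (reg_weight (S I)) (M I) t).
  apply: psdD; apply: psdZ => //; rewrite ?subr_ge0 // ?ltW //.
  exact: psd_reg_weight.
have UE w : dot (segment_mx (reg_weight (S I)) (M I) t *m w) w =
  t * dot (reg_weight (S I) *m w) w + (1 - t) * (dot (K I *m w) w +
    \sum_(J <- L | `[< S J `<=` S I >]) dot (K J *m w) w).
  rewrite mulmxDl dotDl -!scalemxAl !dotZl -MI /mass_in big_cons II /=.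
  by rewrite !mulmxDl !dotDl mulmx_suml dot_suml.
(* [vec I] maximizes [2 <hI, w> - <U w, w>], so it may replace [v]. As [U] counts [K I] and the tail
   does not, the term of [I] in the sum is gained. *)
have h3 := @psd_mixed_le _ _ hF _ _ (vec I) v _ pU ltr01.
have h4 := UE (vec I); have h5 := UE v.
rewrite invr1 !mul1r h5 h4 solI in h3; rewrite solI in h4.
move: h1 h2 h3 h4.
set p1 := psi (S I) / _; set p2 := psi E' / _.
set a1 := dot (hI (S I)) (vec I); set a2 := dot (hI (S I)) v; set a3 := dot (hI E') v.
set w1 := dot (reg_weight (S I) *m vec I) (vec I).
set w2 := dot (reg_weight (S I) *m v) v; set w3 := dot (reg_weight E' *m v) v.
set k1 := dot (K I *m vec I) (vec I); set k2 := dot (K I *m v) v.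
set s1 := \sum_(J <- L | `[< S J `<=` S I >]) dot (K J *m vec I) (vec I).
set s2 := \sum_(J <- L | `[< S J `<=` S I >]) dot (K J *m vec J) (vec J).
set s3 := \sum_(J <- L | `[< S J `<=` S I >]) dot (K J *m v) v.
set s4 := \sum_(J <- L | `[< S J `<=` E' >]) dot (K J *m v) v.
set s5 := \sum_(J <- L | `[< S J `<=` E' >]) dot (K J *m vec J) (vec J).
by lra.
Qed.

Variables (M : T -> 'M[F]_d) (L : seq T) (E : set X).
Hypothesis gL : forall I, I \in L -> [/\ good (S I), S I !=set0 & 0 < mu (S I)].
Hypothesis con : mass_consistent M L.
Hypothesis nes : pairwise nested L.
Hypothesis M_psd : forall I, I \in L -> psd (M I).
Hypothesis M_le : forall I v, I \in L ->
  dot (M I *m v) v <= c * dot (WI (S I) *m v) v.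
Hypothesis gE : good E.
Hypothesis LE : forall I, I \in L -> S I `<=` E.

Lemma reg_weight_ge I v : I \in L ->
  c * (e * mu (S I)) * dot v v <= dot (reg_weight (S I) *m v) v.
Proof.
move=> /gL[gI _ _]; rewrite dot_reg_weight mulrDr -!mulrA lerDr.
by apply: mulr_ge0; [exact: ltW|apply/psd_ge0/WI_psd].
Qed.

Lemma reg_weight_unit I : I \in L -> reg_weight (S I) \in unitmx.
Proof.
move=> IL; have [gI _ m0] := gL IL.
apply: (@herm_unitmx _ _ _ _ _ (c * (e * mu (S I)))).
- exact/psd_herm/psd_reg_weight.
- by rewrite !mulr_gt0.
- by move=> v; exact: reg_weight_ge.
Qed.

Lemma segment_unit I t : I \in L -> 0 < t <= 1 ->
  segment_mx (reg_weight (S I)) (M I) t \in unitmx.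
Proof.
move=> IL /andP[t0 t1]; have [gI _ m0] := gL IL.
apply: (@herm_unitmx _ _ _ _ _ (t * (c * (e * mu (S I))))).
- apply/psd_herm/psdD; apply: psdZ; rewrite ?subr_ge0 // ?ltW //.
    exact: psd_reg_weight.
  exact: M_psd.
- by rewrite !mulr_gt0.
- move=> v; rewrite mulmxDl dotDl -2!scalemxAl !dotZl.
  rewrite -mulrA; apply: (@le_trans _ _ (t * dot (reg_weight (S I) *m v) v)).
    by rewrite ler_pM2l // reg_weight_ge.
  by rewrite lerDl mulr_ge0 ?subr_ge0 //; apply/psd_ge0/M_psd.
Qed.

(** At [v = 0], on a set containing all those of the list, the Bellman estimate retains only the
    sum. *)
Lemma carleson_segment t : 0 < t < 1 ->
  \sum_(J <- L) dot
    (K J *m (invmx (segment_mx (reg_weight (S J)) (M J) t) *m hI (S J)))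
    (invmx (segment_mx (reg_weight (S J)) (M J) t) *m hI (S J))
  <= psi E / (c * (t * (1 - t))).
Proof.
move=> /andP[t0 t1].
pose vec J := invmx (segment_mx (reg_weight (S J)) (M J) t) *m hI (S J).
have gL' I : I \in L -> good (S I) /\ S I !=set0 by move=> /gL[].
have t01 : 0 < t <= 1 by rewrite t0 ltW.
have sol I : I \in L ->
    segment_mx (reg_weight (S I)) (M I) t *m vec I = hI (S I).
  by move=> IL; rewrite /vec mulmxA mulmxV ?mul1mx // segment_unit.
have adm J : J \in L -> S J `<=` E \/ S J `&` E = set0.
  by move=> /LE; left.
have := bellman t01 gL' con nes sol 0 gE adm.
rewrite [X in _ - _ * X + _]big1 => [|J _]; last by rewrite mulmx0 dot0r.
rewrite mulmx0 !dot0r !mulr0 !subr0 add0r big_seq_cond.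
rewrite (eq_bigl (fun J => J \in L)) => [|J]; last first.
  by apply/andP/idP => [[]//|JL]; split=> //; apply/asboolP/LE.
rewrite -big_seq ler_pdivlMr ?mulr_gt0 // => h.
rewrite ler_pdivlMr ?mulr_gt0 ?subr_gt0 //.
by apply: le_trans h; rewrite le_eqVlt; apply/orP; left; apply/eqP; rewrite /vec; ring.
Qed.

(** The weights [al] have total [2 d] and enter twice: in the Cauchy-Schwarz inequality for the
    extrapolated inverse, and in the summation over the nodes. The factor [t (1 - t)] in [b ^ 2]
    cancels the loss in [carleson_segment]. *)
Lemma carleson_reg :
  \sum_(J <- L) dot (K J *m (invmx (reg_weight (S J)) *m hI (S J)))
                     (invmx (reg_weight (S J)) *m hI (S J))
  <= 4 * d%:R ^+ 2 * psi E / c.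
Proof.
have [t [b [al [t01 al0 alE bE mom]]]] := @interpolation R d.
pose q k J := dot
    (K J *m (invmx (segment_mx (reg_weight (S J)) (M J) (t k)) *m hI (S J)))
    (invmx (segment_mx (reg_weight (S J)) (M J) (t k)) *m hI (S J)).
have key J : J \in L ->
  dot (K J *m (invmx (reg_weight (S J)) *m hI (S J)))
      (invmx (reg_weight (S J)) *m hI (S J))
  <= (2 * d%:R) * \sum_k al k * (t k * (1 - t k)) * q k J.
  move=> JL; have [gJ _ _] := gL JL.
  have t01' k : 0 <= t k <= 1.
    by have /andP[a a'] := t01 k; rewrite !ltW.
  have seg k : segment_mx (reg_weight (S J)) (M J) (t k) \in unitmx.
    by apply: segment_unit => //; have /andP[-> /ltW ->] := t01 k.
  have MP v : dot (M J *m v) v <= dot (reg_weight (S J) *m v) v.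
    apply: le_trans (M_le v JL) _; rewrite dot_reg_weight ler_pM2l // lerDl.
    by rewrite !mulr_ge0 ?dot_ge0 // ltW.
  have [be [beb ->]] := inv_extrapolate mom t01' (psd_reg_weight gJ) (M_psd JL)
    MP (reg_weight_unit JL) seg.
  rewrite mulmx_suml.
  under eq_bigr => k _ do rewrite -scalemxAl.
  apply: le_trans (psd_form_sum_le _ _ (K_psd J) al0 beb) _.
  rewrite alE ler_wpM2l ?mulr_ge0 //; apply: ler_sum => k _.
  have -> : `|b k| ^+ 2 / al k = al k * (t k * (1 - t k)).
    by rewrite real_normK ?num_real // bE; field; rewrite gt_eqF // al0.
  by [].
rewrite big_seq; apply: (le_trans (ler_sum _ key)); rewrite -big_seq.
rewrite -mulr_sumr exchange_big /=.
apply: (@le_trans _ _ (2 * d%:R * \sum_k al k * (psi E / c))); last first.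
  by rewrite -mulr_suml alE le_eqVlt; apply/orP; left; apply/eqP; ring.
rewrite ler_wpM2l ?mulr_ge0 //; apply: ler_sum => k _.
rewrite -mulr_sumr -mulrA ler_pM2l //.
have /andP[a1 a2] := t01 k.
have tp : 0 < t k * (1 - t k) by rewrite mulr_gt0 ?subr_gt0.
rewrite mulrC -ler_pdivlMr // -mulrA -invfM.
exact: carleson_segment.
Qed.

End Weight.
Definition mean_weight (J : T) : 'M[F]_d :=
  of_real F (mu (S J))^-1 *: WI (S J).

Definition mean_vec (J : T) : 'cV[F]_d :=
  of_real F (mu (S J))^-1 *: hI (S J).

(* Let [e] tend to 0 in [carleson_reg]: [W (W + e)^-1 h] tends to [h], since
   [2 <h, v> <= psi + <W v, v>] yields [e ^ 2 |(W + e)^-1 h| ^ 2 <= e psi]. *)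
Lemma carleson_limit (c : R) (M A : T -> 'M[F]_d) (L : seq T) (E : set X) :
  0 < c ->
  (forall I, I \in L -> [/\ good (S I), S I !=set0 & 0 < mu (S I)]) ->
  mass_consistent M L -> pairwise nested L ->
  (forall I, I \in L -> psd (M I)) ->
  (forall I v, I \in L -> dot (M I *m v) v <= c * dot (WI (S I) *m v) v) ->
  good E -> (forall I, I \in L -> S I `<=` E) ->
  (forall I, I \in L -> psd (A I)) ->
  (forall I, I \in L -> K I =
     of_real F (mu (S I)) *: (mean_weight I *m A I *m mean_weight I)) ->
  \sum_(J <- L) mu (S J) * dot (A J *m mean_vec J) (mean_vec J)
  <= 4 * d%:R ^+ 2 * c * psi E.
Proof.
move=> c0 gL con nes Mpsd Mle gE LE Apsd KE.
set B := 4 * d%:R ^+ 2 * c * psi E.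
have B0 : 0 <= B by rewrite !mulr_ge0 // ltW.
(* [de] weighs the main part of [mean_vec] against the regularization error and is fixed first; [C]
   depends on it, and [e] is arbitrary afterwards. *)
apply: (@ler_addeps _ _ _ B) => // de de0.
pose C := (1 + de^-1) * \sum_(J <- L) form_bound (A J) * psi (S J).
have C0 : 0 <= C.
  apply: mulr_ge0; first by rewrite addr_ge0 // invr_ge0 ltW.
  by apply: sumr_ge0 => J _; rewrite mulr_ge0 ?form_bound_ge0.
apply: (@ler_addeps _ _ _ C) => // e e0.
have reg := carleson_reg c0 e0 gL con nes Mpsd Mle gE LE.
have unit J : J \in L -> reg_weight c e (S J) \in unitmx.
  exact: reg_weight_unit.
pose y J := invmx (reg_weight c e (S J)) *m hI (S J).
have term J : J \in L -> mu (S J) * dot (A J *m mean_vec J) (mean_vec J) <=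
    (1 + de) * c ^+ 2 * dot (K J *m y J) (y J) +
    e * ((1 + de^-1) * (form_bound (A J) * psi (S J))).
  move=> JL; have [gJ _ m0] := gL J JL.
  have regy : reg_weight c e (S J) *m y J = hI (S J).
    by rewrite /y mulmxA mulmxV ?mul1mx // unit.
  have WIE : WI (S J) = of_real F (mu (S J)) *: mean_weight J.
    by rewrite scalerA -of_realM mulfV ?gt_eqF // of_real1 scale1r.
  pose z := of_real F c *: (mean_weight J *m y J).
  pose s := of_real F (c * e) *: y J.
  (* After division by the measure, the equation for [y] is [c (<W> + e) y = <h>]; [K] controls the
     part [z], and [s] is the error. *)
  have hz : mean_vec J = z + s.
    rewrite /mean_vec -regy /reg_weight -scalemxAl mulmxDl mul_scalar_mx WIE.
    rewrite -scalemxAl scalerA scalerDr !scalerA -!of_realM; congr (_ *: _ + _ *: _).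
      by congr of_real; field; rewrite gt_eqF.
    by congr of_real; field; rewrite gt_eqF.
  have Ky : mu (S J) * dot (A J *m z) z = c ^+ 2 * dot (K J *m y J) (y J).
    have hW : adjoint (mean_weight J) = mean_weight J.
      by rewrite adjointZ psd_herm //; exact: WI_psd.
    rewrite KE // -scalemxAl dotZl -!mulmxA [in RHS]dot_adjoint hW.
    by rewrite /z -scalemxAr dotZl dotZr; ring.
  have ss : mu (S J) * dot s s <= e * psi (S J).
    have h := hI_le (of_real F c *: y J) gJ.
    have hy : dot (hI (S J)) (y J) =
      c * (dot (WI (S J) *m y J) (y J) + e * mu (S J) * dot (y J) (y J)).
      by rewrite -regy dot_reg_weight.
    rewrite dotZr hy -scalemxAr dotZl dotZr in h.
    have w0 : 0 <= dot (WI (S J) *m y J) (y J) by apply/psd_ge0/WI_psd.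
    have y0 : 0 <= dot (y J) (y J) by exact: dot_ge0.
    rewrite /s dotZl dotZr.
    move: h w0 y0; set w := dot (WI (S J) *m y J) (y J); set yy := dot (y J) (y J).
    move=> h w0 y0.
    have -> : mu (S J) * (c * e * (c * e * yy)) = e * (c ^+ 2 * (e * mu (S J) * yy)).
      by ring.
    rewrite ler_pM2l //.
    have q1 : 0 <= c ^+ 2 * w by rewrite mulr_ge0 ?sqr_ge0.
    have q2 : 0 <= c ^+ 2 * (e * mu (S J) * yy).
      by rewrite !mulr_ge0 ?sqr_ge0 // ltW.
    by lra.
  have mix := @psd_mixed_le _ _ hF _ _ z s _ (Apsd J JL) de0.
  have bs := @form_boundP _ _ hF _ (A J) s.
  rewrite hz mulmxDr !dotDl !dotDr (dot_herm s z (psd_herm (Apsd J JL))).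
  rewrite -mulrA -Ky; set zz := dot (A J *m z) z in mix *.
  set zs := dot (A J *m z) s in mix *; set sA := dot (A J *m s) s in mix bs *.
  apply: (@le_trans _ _ (mu (S J) * ((1 + de) * zz + (1 + de^-1) * sA))).
    rewrite ler_pM2l //; lra.
  rewrite mulrDr; apply: lerD; first by rewrite mulrCA.
  rewrite mulrCA [leRHS]mulrCA ler_wpM2l //; first by rewrite addr_ge0 // invr_ge0 ltW.
  apply: le_trans (ler_wpM2l (ltW m0) bs) _.
  by rewrite mulrCA [leRHS]mulrCA ler_wpM2l ?form_bound_ge0.
rewrite big_seq; apply: (le_trans (ler_sum _ term)); rewrite -big_seq.
rewrite big_split /= -!mulr_sumr -/C lerD2r -mulrA.
apply: (@le_trans _ _ ((1 + de) * B)); last by rewrite mulrDl mul1r.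
rewrite ler_pM2l ?addr_gt0 //.
(* The factor [c ^ 2] carried by [z] meets the [1 / c] of [carleson_reg]. *)
apply: (@le_trans _ _ (c ^+ 2 * (4 * d%:R ^+ 2 * psi E / c))).
  by rewrite ler_wpM2l ?sqr_ge0.
by rewrite /B le_eqVlt; apply/orP; left; apply/eqP; field; rewrite gt_eqF.
Qed.

End Carleson.

(** * Measurable matrix functions and their integrals *)

Section MeasurableMatrices.
Context {R : realType} {F : scalars R} {hF : real_or_complex F}.
Context {disp : measure_display} {X : measurableType disp}.

Lemma measurable_mxM m n p (M : X -> 'M[F]_(m, n)) (N : X -> 'M[F]_(n, p)) :
  measurable_mx M -> measurable_mx N -> measurable_mx (fun x => M x *m N x).
Proof.
move=> h h' i j; split.
- under eq_fun do rewrite mxE re_sum.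
  apply: measurable_sum => k; under eq_fun do rewrite reM.
  have [a b] := h i k; have [a' b'] := h' k j.
  by apply: measurable_funB; exact: measurable_funM.
- under eq_fun do rewrite mxE im_sum.
  apply: measurable_sum => k; under eq_fun do rewrite imM.
  have [a b] := h i k; have [a' b'] := h' k j.
  by apply: measurable_funD; exact: measurable_funM.
Qed.

Lemma measurable_mxD m n (M N : X -> 'M[F]_(m, n)) :
  measurable_mx M -> measurable_mx N -> measurable_mx (fun x => M x + N x).
Proof.
move=> h h' i j; have [a b] := h i j; have [a' b'] := h' i j; split.
  by under eq_fun do rewrite mxE reD; exact: measurable_funD.
by under eq_fun do rewrite mxE imD; exact: measurable_funD.
Qed.

Lemma measurable_mxN m n (M : X -> 'M[F]_(m, n)) :
  measurable_mx M -> measurable_mx (fun x => - M x).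
Proof.
move=> h i j; have [a b] := h i j; split.
  by under eq_fun do rewrite mxE reN; exact: measurable_funN.
by under eq_fun do rewrite mxE imN; exact: measurable_funN.
Qed.

Lemma measurable_mx_cst m n (M : 'M[F]_(m, n)) : measurable_mx (fun _ : X => M).
Proof. by move=> i j; split; exact: measurable_cst. Qed.

Lemma measurable_mxZ m n (c : X -> R) (M : X -> 'M[F]_(m, n)) :
  measurable_fun setT c -> measurable_mx M ->
  measurable_mx (fun x => of_real F (c x) *: M x).
Proof.
move=> mc h i j; have [a b] := h i j; split.
  under eq_fun do rewrite mxE reM re_of_real im_of_real mul0r subr0.
  exact: measurable_funM.
under eq_fun do rewrite mxE imM re_of_real im_of_real mul0r addr0.
exact: measurable_funM.
Qed.

Lemma measurable_mx_cvg m n (M : nat -> X -> 'M[F]_(m, n)) (S : X -> 'M[F]_(m, n)) :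
  (forall k, measurable_mx (M k)) ->
  (forall x, cvg_entries \oo (fun k => M k x) (S x)) -> measurable_mx S.
Proof.
move=> h c i j; split.
  apply: (measurable_fun_cvg (h := fun k x => re (M k x i j))).
    by move=> k; have [] := h k i j.
  by move=> x _; have [] := c x i j.
apply: (measurable_fun_cvg (h := fun k x => im (M k x i j))).
  by move=> k; have [] := h k i j.
by move=> x _; have [] := c x i j.
Qed.

Lemma measurable_dot d (u v : X -> 'cV[F]_d) :
  measurable_mx u -> measurable_mx v ->
  measurable_fun setT (fun x => dot (u x) (v x)).
Proof.
move=> h h'; under eq_fun do rewrite dotE; apply: measurable_sum => i.
have [a b] := h i 0; have [a' b'] := h' i 0.
by apply: measurable_funD; exact: measurable_funM.
Qed.

Lemma measurable_form_bound d (M : X -> 'M[F]_d) :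
  measurable_mx M -> measurable_fun setT (fun x => form_bound (M x)).
Proof.
move=> h; apply: measurable_sum => i; apply: measurable_sum => j.
have [a b] := h i j.
apply: measurable_funM; first exact: measurable_cst.
apply: measurable_funD; last exact: measurable_funX.
by apply: measurable_funD; [exact: measurable_cst|exact: measurable_funX].
Qed.

Lemma measurable_sqrt_iter d (Z : X -> 'M[F]_d) k :
  measurable_mx Z -> measurable_mx (fun x => sqrt_iter (Z x) k).
Proof.
move=> h; elim: k => [|k IH] /=; first exact: measurable_mx_cst.
apply: (measurable_mxZ (c := fun=> 2^-1)); first exact: measurable_cst.
by apply: measurable_mxD => //; exact: measurable_mxM.
Qed.

(** The square root is the pointwise limit of [sqrt_approx], which is built from the entries by
    arithmetic and a scalar square root. *)
Lemma measurable_psd_sqrt d (W : X -> 'M[F]_d) :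
  measurable_mx W -> (forall x, psd (W x)) ->
  measurable_mx (fun x => psd_sqrt (W x)).
Proof.
move=> h p; apply: (@measurable_mx_cvg _ _ (fun k x => sqrt_approx (W x) k)).
  move=> k; rewrite /sqrt_approx.
  have mc : measurable_fun setT (fun x => 1 + form_bound (W x)).
    apply: measurable_funD; first exact: measurable_cst.
    exact: measurable_form_bound.
  apply: measurable_mxZ.
    apply: (measurableT_comp (f := @Num.sqrt R)) => //.
    by apply: continuous_measurable_fun; apply: sqrt_continuous.
  apply: measurable_mxD; first exact: measurable_mx_cst.
  apply: measurable_mxN; apply: measurable_sqrt_iter.
  apply: measurable_mxD; first exact: measurable_mx_cst.
  apply: measurable_mxN.
  apply: (measurable_mxZ (c := fun x => (1 + form_bound (W x))^-1)) => //.
  (* The argument is positive, so its reciprocal is the exponential of minus its logarithm. *)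
  rewrite (_ : (fun x => _) =
      expR \o (-%R \o (@ln R \o (fun x => 1 + form_bound (W x))))).
    apply: measurableT_comp; first exact: measurable_expR.
    apply: measurableT_comp => //.
    by apply: measurableT_comp => //; exact: measurable_ln.
  apply/funext => x /=; rewrite expRN lnK // posrE.
  by rewrite ltr_wpDr ?form_bound_ge0.
by move=> x; have [] := psd_sqrt_spec (p x).
Qed.

End MeasurableMatrices.

Section MatrixIntegral.
Context {R : realType} {F : scalars R} {hF : real_or_complex F}.
Context {disp : measure_display} {X : measurableType disp}.
Variable sigma : {measure set X -> \bar R}.
Variables (E : set X) (mE : measurable E).

Definition has_int (f : X -> R) (l : R) : Prop :=
  sigma.-integrable E (fun x => (f x)%:E) /\ \int[sigma]_(x in E) f x = l.

Lemma has_intD f g a b : has_int f a -> has_int g b ->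
  has_int (fun x => f x + g x) (a + b).
Proof.
move=> [fi <-] [gi <-]; split; last exact: RintegralD.
by have := integrableD mE fi gi; apply: eq_integrable.
Qed.

Lemma has_intZ c f a : has_int f a -> has_int (fun x => c * f x) (c * a).
Proof.
move=> [fi <-]; split; last exact: RintegralZl.
by have := integrableZl mE c fi; apply: eq_integrable.
Qed.

Lemma has_int0 : has_int (fun=> 0) 0.
Proof. by split; [exact: integrable0|rewrite Rintegral_cst // mul0r]. Qed.

Lemma has_int_eq f g a b : f =1 g -> a = b -> has_int f a -> has_int g b.
Proof. by move=> /funext -> ->. Qed.

Lemma has_int_sum (T : eqType) (r : seq T) (f : T -> X -> R) (a : T -> R) :
  (forall i, i \in r -> has_int (f i) (a i)) ->
  has_int (fun x => \sum_(i <- r) f i x) (\sum_(i <- r) a i).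
Proof.
elim: r => [|i r IH] h.
  by rewrite big_nil; under eq_fun do rewrite big_nil; exact: has_int0.
rewrite big_cons; under eq_fun do rewrite big_cons.
apply: has_intD; first by apply: h; exact: mem_head.
by apply: IH => j jr; apply: h; rewrite inE jr orbT.
Qed.

Lemma has_int_le f g a b : has_int f a -> has_int g b ->
  (forall x, f x <= g x) -> a <= b.
Proof. by move=> [fi <-] [gi <-] h; apply: le_Rintegral. Qed.

Definition has_int_mx m n (G : X -> 'M[F]_(m, n)) (S : 'M[F]_(m, n)) : Prop :=
  forall i j, has_int (fun x => re (G x i j)) (re (S i j)) /\
              has_int (fun x => im (G x i j)) (im (S i j)).

(** Over the reals [of_re_im] discards its second argument, but there the integrated imaginary part
    is 0. *)
Lemma im_of_integral a (g : X -> F) :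
  im (of_re_im F a (\int[sigma]_(x in E) im (g x))) =
  \int[sigma]_(x in E) im (g x).
Proof.
by case: hF g => -> //= g; rewrite Rintegral_cst // mul0r.
Qed.

Lemma integral_mxP m n (G : X -> 'M[F]_(m, n)) :
  integrable_mx sigma E G -> has_int_mx G (integral_mx sigma E G).
Proof.
move=> h i j; have [a b] := h i j.
by rewrite mxE re_of (im_of_integral _ (fun x => G x i j)); split; split.
Qed.

Lemma has_int_mxP m n (G : X -> 'M[F]_(m, n)) S :
  has_int_mx G S -> integral_mx sigma E G = S.
Proof.
move=> h; apply/matrixP => i j; have [[_ a] [_ b]] := h i j.
by rewrite mxE a b of_re_imK.
Qed.

Lemma has_int_mxM m n p (G : X -> 'M[F]_(m, n)) S (N : 'M[F]_(n, p)) :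
  has_int_mx G S -> has_int_mx (fun x => G x *m N) (S *m N).
Proof.
move=> h i j; split.
- rewrite mxE re_sum; under eq_fun do rewrite mxE re_sum.
  apply: has_int_sum => k _; have [a b] := h i k; rewrite reM.
  apply: (has_int_eq _ _ (has_intD (has_intZ (re (N k j)) a) (has_intZ (- im (N k j)) b))).
    by move=> x; rewrite reM; ring.
  by ring.
- rewrite mxE im_sum; under eq_fun do rewrite mxE im_sum.
  apply: has_int_sum => k _; have [a b] := h i k; rewrite imM.
  apply: (has_int_eq _ _ (has_intD (has_intZ (im (N k j)) a) (has_intZ (re (N k j)) b))).
    by move=> x; rewrite imM; ring.
  by ring.
Qed.

Lemma has_int_dot d (h : X -> 'cV[F]_d) S v :
  has_int_mx h S -> has_int (fun x => dot (h x) v) (dot S v).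
Proof.
move=> hS; rewrite dotE; under eq_fun do rewrite dotE.
apply: has_int_sum => i _; have [a b] := hS i 0.
apply: (has_int_eq _ _ (has_intD (has_intZ (re (v i 0)) a) (has_intZ (im (v i 0)) b))).
  by move=> x; ring.
by ring.
Qed.

Lemma integral_mx_psd d (W : X -> 'M[F]_d) :
  integrable_mx sigma E W -> (forall x, psd (W x)) ->
  psd (integral_mx sigma E W).
Proof.
move=> iW p; have hW := integral_mxP iW; apply/psdP; split.
  apply/matrixP => i j; rewrite mxE mxE.
  have [[_ a] [_ b]] := hW i j; have [[_ a'] [_ b']] := hW j i.
  have e x : W x j i = conj (W x i j) by rewrite -{1}(psd_herm (p x)) !mxE.
  apply: re_im_inj; rewrite ?re_conj ?im_conj.
    by rewrite -a -a'; under eq_Rintegral do rewrite e re_conj.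
  rewrite -b -b'; under eq_Rintegral do rewrite e im_conj -mulN1r.
  rewrite RintegralZl //; last by have [] := iW i j.
  by rewrite mulN1r opprK.
move=> v; have := has_int_dot v (has_int_mxM v hW) => -[_ <-].
by apply: Rintegral_ge0 => x _; exact: psd_ge0.
Qed.

End MatrixIntegral.

(** * The embedding theorems *)

Section Embeddings.
Context {R : realType} {F : scalars R} {hF : real_or_complex F}.
Context {disp : measure_display} {X : measurableType disp}.
Context {sigma : {measure set X -> \bar R}} {Fil : atomic_filtration sigma}.

(** * Atoms and dominated functions *)

Lemma atom_measurable I : all_atoms Fil I -> measurable I.1.
Proof. by move=> /atoms_salgebra; exact: salgebra_measurable. Qed.

Lemma atom_finite I : all_atoms Fil I -> (sigma I.1 < +oo)%E.
Proof. by move=> /atoms_finite. Qed.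

Lemma atom_fin_num I : all_atoms Fil I -> sigma I.1 \is a fin_num.
Proof. by move=> /atom_finite h; rewrite ge0_fin_numE. Qed.

(** [I] belongs to the sigma-algebra of the larger rank too, hence is a union of atoms of that rank;
    if [J] meets it, then [J] is one of them. *)
Lemma atoms_nested I J : all_atoms Fil I -> all_atoms Fil J -> (I.2 <= J.2)%R ->
  J.1 `<=` I.1 \/ J.1 `&` I.1 = set0.
Proof.
move=> aI aJ IJ.
have [P Pat IE] := atoms_cover (salgebra_incr IJ (atoms_salgebra aI)).
case: (pselect (J.1 `&` I.1 = set0)) => [?|/eqP/set0P[y [Jy Iy]]]; first by right.
left; move: Iy; rewrite IE => -[Q PQ Qy].
have <- : Q = J.1.
  by apply: (atoms_disjoint (Pat _ PQ) aJ); exists y.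
by move=> x Qx; exists Q.
Qed.

Lemma atoms_same_rank I J : all_atoms Fil I -> all_atoms Fil J -> I.2 = J.2 ->
  I.1 !=set0 -> I.1 `<=` J.1 -> I = J.
Proof.
move=> aI aJ e [y Iy] IJ; rewrite [I]surjective_pairing [J]surjective_pairing e.
congr (_, _); rewrite /all_atoms /= e in aI.
by apply: (atoms_disjoint aI aJ); exists y; split=> //; exact: IJ.
Qed.

Context {d : nat} {W : X -> 'M[F]_d} (hW : matrix_weight Fil W).
Context {A : set X * int -> 'M[F]_d} (hA : forall I, all_atoms Fil I -> psd (A I)).

Definition mass (I : set X * int) : R := fine (sigma I.1).

Lemma mass_ge0 I : 0 <= mass I.
Proof. exact/fine_ge0/measure_ge0. Qed.

(* Instances: [h = W^(1/2) f] with [psi = |f|^2], and [h = W f] with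
   [psi = <W f, f>]. *)
Definition dominated (h : X -> 'cV[F]_d) (psi : X -> R) : Prop :=
  [/\ measurable_mx h, measurable_fun setT psi, forall x, 0 <= psi x,
      (\int[sigma]_x (psi x)%:E < +oo)%E &
      forall x v, 2 * dot (h x) v <= psi x + dot (W x *m v) v].

Lemma dominated_integrable h psi : dominated h psi ->
  sigma.-integrable setT (fun x => (psi x)%:E).
Proof.
move=> [_ mpsi psi0 fpsi _]; apply/integrableP; split; first exact/measurable_EFinP.
by under eq_integral do rewrite /= ger0_norm //.
Qed.

(** Domination at [v] and at [- v] bounds [|<h, v>|] by [psi + <W v, v>]; basis vectors and their
    multiples by [i] give the entries. *)
Lemma dominated_integrable_mx h psi E : dominated h psi -> measurable E ->
  integrable_mx sigma E W -> integrable_mx sigma E h.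
Proof.
move=> dom mE iW; have [mh mpsi psi0 fpsi le_h] := dom.
have ipsi : sigma.-integrable E (fun x => (psi x)%:E).
  by apply: integrableS (dominated_integrable dom).
have bound f v : measurable_fun setT f -> (forall x, f x = dot (h x) v) ->
    sigma.-integrable E (fun x => (f x)%:E).
  move=> mf fE.
  have [iv _] := has_int_dot mE v (has_int_mxM mE v (integral_mxP mE iW)).
  apply: (le_integrable mE _ _ (integrableD mE ipsi iv)).
    by apply/measurable_EFinP; apply: measurable_funTS.
  move=> x _ /=; rewrite lee_fin fE.
  have v0 : 0 <= dot (W x *m v) v by case: hW => _ p _; exact: psd_ge0.
  have h1 := le_h x v; have h2 := le_h x (- v).
  rewrite mulmxN dotNl !dotNr opprK in h2.
  rewrite [leRHS]ger0_norm ?addr_ge0 //; have := psi0 x.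
  by rewrite ler_norml => p0; apply/andP; split; lra.
move=> i j; rewrite ord1; have [mr mi] := mh i 0; split.
  by apply: (bound _ (delta_mx i 0)) => // x; rewrite dot_deltar.
apply: (bound _ (of_re_im F 0 1 *: delta_mx i 0)) => // x.
by rewrite dot_ideltar.
Qed.

(** The packing condition in terms of forms and finite sums, multiplied by [|I0|];
    [carleson_packingP] proves the equivalence. *)
Definition packing_sums (c : R) : Prop :=
  forall I0, all_atoms Fil I0 -> sigma I0.1 != 0%E ->
  forall (r : seq (set X * int)) (v : 'cV[F]_d), uniq r ->
  (forall I, I \in r -> atoms_in Fil I0 I) ->
  \sum_(I <- r) mass I *
    dot ((average sigma I.1 W *m A I *m average sigma I.1 W) *m v) v
  <= c * (mass I0 * dot (average sigma I0.1 W *m v) v).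

(** * Finite unions of atoms and averages *)

Definition good_set (E : set X) : Prop :=
  [/\ measurable E, (sigma E < +oo)%E & integrable_mx sigma E W].

Lemma setUDE (E I : set X) : E `|` I = E `|` (I `\` E).
Proof. by rewrite setUDr setDv setD0. Qed.

Lemma integrable_setU2 (f : X -> R) (E I : set X) : measurable E -> measurable I ->
  sigma.-integrable E (fun x => (f x)%:E) ->
  sigma.-integrable I (fun x => (f x)%:E) ->
  sigma.-integrable (E `|` I) (fun x => (f x)%:E).
Proof.
move=> mE mI iE iI.
have mD : measurable (I `\` E) by exact: measurableD.
have /integrableP[mfD iD] : sigma.-integrable (I `\` E) (fun x => (f x)%:E).
  by apply: integrableS iI.
have /integrableP[mfE {}iE] := iE; rewrite setUDE; apply/integrableP.
have mf : measurable_fun (E `|` (I `\` E)) (fun x => (f x)%:E).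
  exact/measurable_funU.
split=> //; rewrite ge0_integral_setU //.
- by rewrite lte_add_pinfty.
- exact: measurableT_comp.
- by apply/disj_set2P; rewrite setDE setICA setICr setI0.
Qed.

Lemma good_set_setD E I : good_set E -> good_set I -> good_set (E `\` I).
Proof.
move=> [mE fE iE] [mI _ _]; have mD : measurable (E `\` I) by exact: measurableD.
split=> //.
  by apply: le_lt_trans fE; apply: le_measure; rewrite ?inE //; exact: subDsetl.
move=> i j; have [a b] := iE i j.
by split; [apply: integrableS a|apply: integrableS b].
Qed.

Lemma good_set_setU E I : good_set E -> good_set I -> good_set (E `|` I).
Proof.
move=> [mE fE iE] [mI fI iI]; split; first exact: measurableU.
  have mD : measurable (I `\` E) by exact: measurableD.
  rewrite setUDE measureU //; last by rewrite setDE setICA setICr setI0.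
  rewrite lte_add_pinfty //; apply: le_lt_trans fI.
  by apply: le_measure; rewrite ?inE //; exact: subDsetl.
move=> i j; have [a b] := iE i j; have [a' b'] := iI i j.
by split; exact: integrable_setU2.
Qed.

Lemma good_set0 : good_set set0.
Proof.
split; [exact: measurable0|by rewrite measure0|].
by move=> i j; split; exact: integrable_set0.
Qed.

Lemma atom_good I : all_atoms Fil I -> good_set I.1.
Proof.
move=> aI; split; [exact: atom_measurable aI|exact: atom_finite aI|].
by case: hW => _ _; apply.
Qed.

Lemma Rintegral_split (f : X -> R) (E I : set X) : measurable E -> measurable I ->
  I `<=` E -> sigma.-integrable E (fun x => (f x)%:E) ->
  \int[sigma]_(x in E) f x =
  \int[sigma]_(x in I) f x + \int[sigma]_(x in E `\` I) f x.
Proof.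
move=> mE mI IE iE; have mD : measurable (E `\` I) by exact: measurableD.
rewrite -{1}(setDUK IE) Rintegral_setU //; first by rewrite setDUK.
by apply/disj_set2P; rewrite setDE setICA setICr setI0.
Qed.

Lemma mass_gt0 I : all_atoms Fil I -> sigma I.1 != 0%E -> 0 < mass I.
Proof.
by move=> aI s0; rewrite fine_gt0 // atom_finite // andbT lt0e s0 measure_ge0.
Qed.

Lemma averageE m n (G : X -> 'M[F]_(m, n)) (I : set X * int) : sigma I.1 != 0%E ->
  average sigma I.1 G = of_real F (mass I)^-1 *: integral_mx sigma I.1 G.
Proof. by rewrite /average => /negPf ->. Qed.

Lemma average_null m n (G : X -> 'M[F]_(m, n)) (I : set X * int) : sigma I.1 = 0%E ->
  average sigma I.1 G = 0.
Proof. by rewrite /average => ->; rewrite eqxx. Qed.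

Lemma integral_averageE m n (G : X -> 'M[F]_(m, n)) (I : set X * int) : all_atoms Fil I ->
  sigma I.1 != 0%E ->
  integral_mx sigma I.1 G = of_real F (mass I) *: average sigma I.1 G.
Proof.
move=> aI s0; rewrite averageE // scalerA -of_realM mulfV ?of_real1 ?scale1r //.
by rewrite gt_eqF // mass_gt0.
Qed.

Lemma average_psd I : all_atoms Fil I -> psd (average sigma I.1 W).
Proof.
move=> aI; have [mI _ iI] := atom_good aI; have [_ pW _] := hW.
have [s0|s0] := eqVneq (sigma I.1) 0%E.
  by rewrite average_null //; exact: psd0.
rewrite averageE //; apply: psdZ; first by rewrite invr_ge0 mass_ge0.
exact: integral_mx_psd.
Qed.

Lemma packing_term_psd I : all_atoms Fil I ->
  psd (average sigma I.1 W *m A I *m average sigma I.1 W).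
Proof.
move=> aI; rewrite -{1}(psd_herm (average_psd aI)).
by apply: psd_sandwich; exact: hA.
Qed.

Lemma integral_split_mx m n (G : X -> 'M[F]_(m, n)) (E I : set X) :
  measurable E -> measurable I -> I `<=` E -> integrable_mx sigma E G ->
  integral_mx sigma E G = integral_mx sigma I G + integral_mx sigma (E `\` I) G.
Proof.
move=> mE mI IE iG; apply/matrixP => i j; have [a b] := iG i j.
have mD : measurable (E `\` I) by exact: measurableD.
rewrite !mxE; apply: re_im_inj; rewrite ?reD ?imD ?re_of.
  exact: Rintegral_split.
rewrite (im_of_integral sigma mE _ (fun x => G x i j)).
rewrite (im_of_integral sigma mI _ (fun x => G x i j)).
rewrite (im_of_integral sigma mD _ (fun x => G x i j)).
exact: Rintegral_split.
Qed.

Lemma carleson_dominated_pos c h psi (r : seq (set X * int)) :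
  0 < c -> packing_sums c -> dominated h psi -> uniq r ->
  (forall I, I \in r -> all_atoms Fil I /\ sigma I.1 != 0%E) ->
  \sum_(I <- r) mass I *
     dot (A I *m average sigma I.1 h) (average sigma I.1 h)
  <= 4 * d%:R ^+ 2 * c * \int[sigma]_x psi x.
Proof.
move=> c0 pack dom ur ar; have [mh mpsi psi0 fpsi le_h] := dom.
have [_ pW _] := hW.
pose le2 (I J : set X * int) := (I.2 <= J.2)%R.
(* Coarse atoms come first, as the Bellman induction requires; atoms of equal rank are equal or
   disjoint. *)
pose L := sort le2 r.
have pL : perm_eq L r by rewrite perm_sort.
rewrite -(perm_big _ pL) /=.
have uL : uniq L by rewrite (perm_uniq pL).
have aL I : I \in L -> all_atoms Fil I /\ sigma I.1 != 0%E.
  by rewrite (perm_mem pL); exact: ar.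
have neL I : I \in L -> I.1 !=set0.
  by move=> /aL[_ s0]; apply/set0P; apply: contra_neq s0 => ->; rewrite measure0.
have sL : pairwise (fun I J => le2 I J && (I != J)) L.
  rewrite pairwise_relI -uniq_pairwise uL andbT -sorted_pairwise.
    by apply: sort_sorted => I J; exact: le_total.
  by move=> J I K; exact: le_trans.
pose E := \big[setU/set0]_(I <- L) I.1.
have gE : good_set E.
  rewrite /E big_seq; elim/big_ind: _ => [||I /aL[aI _]].
  - exact: good_set0.
  - exact: good_set_setU.
  - exact: atom_good.
have LE I : I \in L -> I.1 `<=` E.
  move=> IL x Ix; rewrite /E; elim: L IL {pL uL aL neL sL E gE} => // J L IH.
  by rewrite big_cons inE => /predU1P[<-|/IH ?]; [left|right].
(* Set to 0 on pairs that are not atoms, because [K] must be positive at every index. *)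
pose K I := if `[< all_atoms Fil I >] then
  of_real F (mass I) *: (average sigma I.1 W *m A I *m average sigma I.1 W) else 0.
have pK I : psd (K I).
  rewrite /K; case: ifPn => [/asboolP aI|_]; last exact: psd0.
  by apply: psdZ; [exact: mass_ge0|exact: packing_term_psd].
pose below (J I : set X * int) := `[< J.1 `<=` I.1 >] && le2 I J.
pose M I := \sum_(J <- L | below J I) K J.
(* [M] sums over the whole list, consistency over tails. An atom listed before [I], contained in [I]
   and of rank at least that of [I], would have the same rank and hence be [I]. *)
have con : mass_consistent fst K M L.
  have gen L1 L2 : L = L1 ++ L2 -> mass_consistent fst K M L2.
    elim: L2 L1 => // I L2 IH L1 LE12 /=; split; last first.
      by apply: (IH (rcons L1 I)); rewrite cat_rcons.
    have IL : I \in L by rewrite LE12 mem_cat mem_head orbT.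
    move: sL; rewrite LE12 pairwise_cat /= => /and4P[/allrelP s12 _ /allP sI _].
    rewrite /M LE12 big_cat /= [X in _ = X + _]big1_seq => [|J /andP[]].
      rewrite add0r /mass_in [LHS]big_seq_cond [RHS]big_seq_cond.
      apply: eq_bigl => J; case: (boolP (J \in _)) => //= JI2.
      rewrite /below; suff -> : le2 I J by rewrite andbT.
      move: JI2; rewrite inE => /predU1P[->|/sI/andP[]//]; exact: lexx.
    move=> /andP[/asboolP JI le_IJ] JL1.
    have JL : J \in L by rewrite LE12 mem_cat JL1.
    have /andP[le_JI] := s12 J I JL1 (mem_head _ _).
    have [aJ _] := aL J JL; have [aI _] := aL I IL.
    by rewrite (atoms_same_rank aJ aI _ (neL J JL) JI) ?eqxx //; apply/le_anti/andP.
  exact: (gen [::]).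
have nes : pairwise (nested fst) L.
  apply: (@sub_in_pairwise _ [in L] _ _ _ _ _ sL); last exact/allP.
  move=> I J /= /aL[aI _] /aL[aJ _] /andP[IJ _]; apply/asboolP.
  exact: atoms_nested.
have iX := dominated_integrable dom.
have ipsi E' : measurable E' -> sigma.-integrable E' (fun x => (psi x)%:E).
  by move=> mE'; apply: integrableS iX.
have ih E' : good_set E' -> integrable_mx sigma E' h.
  by move=> [mE' _ iE']; exact: dominated_integrable_mx dom mE' iE'.
have EX : \int[sigma]_(x in E) psi x <= \int[sigma]_x psi x.
  have [mE _ _] := gE.
  rewrite [leRHS](Rintegral_split measurableT mE) // lerDl.
  exact: Rintegral_ge0.
apply: (@le_trans _ _ (4 * d%:R ^+ 2 * c * \int[sigma]_(x in E) psi x)); last first.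
  by rewrite ler_wpM2l // !mulr_ge0 // ltW.
pose mu E := fine (sigma E).
pose hI E := integral_mx sigma E h.
pose WI E := integral_mx sigma E W.
pose pI E := \int[sigma]_(x in E) psi x.
have -> : \sum_(J <- L) mass J * dot (A J *m average sigma J.1 h) (average sigma J.1 h)
    = \sum_(J <- L) mu J.1 * dot (A J *m mean_vec mu hI fst J) (mean_vec mu hI fst J).
  rewrite big_seq [RHS]big_seq; apply: eq_bigr => J /aL[aJ s0].
  by rewrite averageE.
have mu_split E' I : good_set E' -> good_set I -> I `<=` E' ->
    mu E' = mu I + mu (E' `\` I).
  move=> [mE fE _] [mI fI _] IE; have mD : measurable (E' `\` I) by exact: measurableD.
  have fD : (sigma (E' `\` I) < +oo)%E.
    by apply: le_lt_trans fE; apply: le_measure; rewrite ?inE //; exact: subDsetl.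
  rewrite /mu -fineD ?ge0_fin_numE // -measureU ?setDUK //.
  by rewrite setDE setICA setICr setI0.
have hI_split E' I : good_set E' -> good_set I -> I `<=` E' ->
    hI E' = hI I + hI (E' `\` I).
  move=> gE' [mI _ _] IE; have [mE' _ _] := gE'.
  by apply: integral_split_mx => //; exact: ih.
have WI_split E' I : good_set E' -> good_set I -> I `<=` E' ->
    WI E' = WI I + WI (E' `\` I).
  by move=> [mE _ iE] [mI _ _] IE; exact: integral_split_mx.
have pI_split E' I : good_set E' -> good_set I -> I `<=` E' ->
    pI E' = pI I + pI (E' `\` I).
  by move=> [mE _ _] [mI _ _] IE; apply: Rintegral_split => //; exact: ipsi.
have mu0 E' : 0 <= mu E' by exact/fine_ge0/measure_ge0.
have pI0 E' : 0 <= pI E' by exact: Rintegral_ge0.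
have WI0 E' : good_set E' -> psd (WI E').
  by move=> [mE _ iE]; exact: integral_mx_psd.
have hI_le E' v : good_set E' -> 2 * dot (hI E') v <= pI E' + dot (WI E' *m v) v.
  move=> gE'; have [mE' _ iE'] := gE'.
  have h1 : has_int sigma E' (fun x => dot (h x) v) (dot (hI E') v).
    by apply: has_int_dot => //; apply: integral_mxP => //; exact: ih.
  have h2 : has_int sigma E' (fun x => dot (W x *m v) v) (dot (WI E' *m v) v).
    by apply: has_int_dot => //; apply: has_int_mxM => //; exact: integral_mxP.
  have h3 : has_int sigma E' psi (pI E') by split; first exact: ipsi.
  by apply: (has_int_le mE' (has_intZ mE' 2 h1) (has_intD mE' h3 h2)) => x.
have KE I : I \in L -> K I =
    of_real F (mu I.1) *: (mean_weight mu WI fst I *m A I *m mean_weight mu WI fst I).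
  move=> /aL[aI s0]; rewrite /K; have -> : `[< all_atoms Fil I >] = true by apply/asboolP.
  by rewrite averageE.
apply: (carleson_limit good_set_setD mu_split hI_split WI_split pI_split mu0 pI0
  WI0 hI_le pK c0 _ con nes _ _ gE LE _ KE).
- by move=> I IL; have [aI s0] := aL I IL; split;
    [exact: atom_good|exact: neL|exact: mass_gt0].
- by move=> I _; exact: psd_sum.
- move=> I v IL; have [aI s0] := aL I IL.
  have WIE : WI I.1 = of_real F (mass I) *: average sigma I.1 W.
    exact: integral_averageE.
  rewrite WIE -scalemxAl dotZl /M -big_filter mulmx_suml dot_suml.
  apply: le_trans (pack I aI s0 [seq J <- L | below J I] v _ _); last 2 first.
  + exact: filter_uniq.
  + move=> J; rewrite mem_filter => /andP[/andP[/asboolP JI IJ] /aL[aJ _]].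
    by split.
  rewrite le_eqVlt; apply/orP; left; apply/eqP.
  rewrite big_seq [RHS]big_seq; apply: eq_bigr => J.
  rewrite mem_filter => /andP[_ /aL[aJ _]].
  rewrite /K; have -> : `[< all_atoms Fil J >] = true by apply/asboolP.
  by rewrite -scalemxAl dotZl.
- by move=> I /aL[aI _]; exact: hA.
Qed.

(** * Finite sums and duality *)

Definition finite_carleson_sum (g : X -> 'cV[F]_d) (r : seq (set X * int)) : R :=
  \sum_(I <- r) mass I *
     dot (A I *m average sigma I.1 g) (average sigma I.1 g).

Lemma carleson_sum_le g (C : R) :
  (carleson_sum Fil A g <= C%:E)%E <->
  (forall r, uniq r -> (forall I, I \in r -> all_atoms Fil I) ->
     finite_carleson_sum g r <= C).
Proof.
pose t I := ((vnorm (psd_sqrt (A I) *m average sigma I.1 g) ^+ 2)%:E * sigma I.1)%E.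
have tE I : all_atoms Fil I ->
    t I = (mass I * dot (A I *m average sigma I.1 g) (average sigma I.1 g))%:E.
  move=> aI; rewrite /t vnormE dot_psd_sqrt; last exact: hA.
  by rewrite -(fineK (atom_fin_num aI)) -EFinM mulrC.
split=> [le_C r ur ar|le_C].
  rewrite -lee_fin; apply: le_trans le_C; apply: esum_ge.
  exists [set` r]; first by split=> //=; exact: ar.
  rewrite -(fsbig_seq _ _ ur) /finite_carleson_sum -sumEFin.
  rewrite big_seq [leRHS]big_seq le_eqVlt; apply/orP; left; apply/eqP.
  by apply: eq_bigr => I /ar /tE.
apply: ge_ereal_sup => _ [D [fD DA] <-].
rewrite fsbig_finite //= big_seq (eq_bigr (fun I => (mass I *
    dot (A I *m average sigma I.1 g) (average sigma I.1 g))%:E)); last first.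
  by move=> I; rewrite in_fset_set // inE => /DA /tE.
rewrite -big_seq sumEFin lee_fin; apply: le_C; first exact: fset_uniq.
by move=> I; rewrite in_fset_set // inE => /DA.
Qed.

Lemma has_int_indic (E : set X) (f : X -> R) l : measurable E ->
  has_int sigma E f l -> has_int sigma setT (fun x => \1_E x * f x) l.
Proof.
move=> mE [fi <-]; split.
  have := (integrable_mkcond _ mE).1 fi; apply: eq_integrable => // x _.
  by rewrite epatch_indic /= EFinM muleC.
rewrite [RHS]Rintegral_mkcond patch_indic.
by apply: eq_Rintegral => x _ /=; rewrite mulrC.
Qed.

Lemma has_int_ereal (E : set X) f l : measurable E -> has_int sigma E f l ->
  (\int[sigma]_(x in E) (f x)%:E)%E = l%:E.
Proof.
by move=> mE [fi <-]; rewrite /Rintegral fineK //; exact: integrable_fin_num fi.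
Qed.

Lemma measurable_mx_sum m n (T : Type) (r : seq T) (G : T -> X -> 'M[F]_(m, n)) :
  (forall i, measurable_mx (G i)) ->
  measurable_mx (fun x => \sum_(i <- r) G i x).
Proof.
move=> h; elim: r => [|i r IH].
  by under eq_fun do rewrite big_nil; exact: measurable_mx_cst.
by under eq_fun do rewrite big_cons; exact: measurable_mxD.
Qed.

Lemma indic_integrable (E J : set X) (f : X -> R) : measurable E -> measurable J ->
  sigma.-integrable E (fun x => (f x)%:E) ->
  sigma.-integrable E (fun x => (\1_J x * f x)%:E).
Proof.
move=> mE mJ fi; apply: (le_integrable mE _ _ fi).
  apply/measurable_EFinP; apply: measurable_funM.
    by apply: measurable_funTS; exact: measurable_indic.
  by apply/measurable_EFinP; exact: measurable_int fi.
move=> x _ /=; rewrite lee_fin normrM ler_piMl // indicE.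
by case: (_ \in _); rewrite ?normr1 ?normr0.
Qed.

Lemma integrable_mx_steps (E : set X) (r : seq (set X * int))
    (u : set X * int -> 'cV[F]_d) :
  good_set E -> (forall I, I \in r -> measurable I.1) ->
  integrable_mx sigma E
    (fun x => W x *m \sum_(I <- r) of_real F (\1_(I.1) x) *: u I).
Proof.
move=> [mE _ iE] mr i j.
have e x : W x *m \sum_(I <- r) of_real F (\1_(I.1) x) *: u I =
    \sum_(I <- r) of_real F (\1_(I.1) x) *: (W x *m u I).
  by rewrite mulmx_sumr; apply: eq_bigr => I _; rewrite scalemxAr.
have iI I : has_int_mx sigma E (fun x => W x *m u I) (integral_mx sigma E W *m u I).
  by apply: has_int_mxM => //; exact: integral_mxP.
pose l f := \int[sigma]_(x in E) f x.
have [Hr _] : has_int sigma E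
    (fun x => \sum_(I <- r) \1_(I.1) x * re ((W x *m u I) i j))
    (\sum_(I <- r) l (fun x => \1_(I.1) x * re ((W x *m u I) i j))).
  apply: has_int_sum => // I Ir; have [[a _] _] := iI I i j.
  by split=> //; apply: indic_integrable => //; exact: mr.
have [Hi _] : has_int sigma E
    (fun x => \sum_(I <- r) \1_(I.1) x * im ((W x *m u I) i j))
    (\sum_(I <- r) l (fun x => \1_(I.1) x * im ((W x *m u I) i j))).
  apply: has_int_sum => // I Ir; have [_ [a _]] := iI I i j.
  by split=> //; apply: indic_integrable => //; exact: mr.
split.
  apply: eq_integrable Hr => // x _; rewrite e summxE re_sum; congr (_%:E).
  by apply: eq_bigr => I _; rewrite [in RHS]mxE reM re_of_real im_of_real mul0r subr0.
apply: eq_integrable Hi => // x _; rewrite e summxE im_sum; congr (_%:E).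
by apply: eq_bigr => I _; rewrite [in RHS]mxE imM re_of_real im_of_real mul0r addr0.
Qed.

Lemma dot_integral_average (g : X -> 'cV[F]_d) I u : all_atoms Fil I ->
  sigma I.1 != 0%E ->
  dot (integral_mx sigma I.1 g) u = mass I * dot (average sigma I.1 g) u.
Proof. by move=> aI s0; rewrite integral_averageE // dotZl. Qed.

(* Test the embedding on [G = sum_I 1_I A_I <h>_I]: the integral of [<h, G>] is
   the sum to be estimated. *)
Lemma embedding_duality (a : R) h psi (r : seq (set X * int)) :
  0 < a -> embedding_L2W Fil W A a -> dominated h psi -> uniq r ->
  (forall I, I \in r -> all_atoms Fil I /\ sigma I.1 != 0%E) ->
  finite_carleson_sum h r <= a * \int[sigma]_x psi x.
Proof.
move=> a0 emb dom ur ar; have [mh mpsi psi0 fpsi le_h] := dom.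
have [mW pW _] := hW.
pose u I := A I *m average sigma I.1 h.
pose G x := \sum_(I <- r) of_real F (\1_(I.1) x) *: u I.
have mr I : I \in r -> measurable I.1 by move=> /ar[/atom_measurable].
have mG : measurable_mx G.
  (* Indicators of nonmeasurable sets, which do not come from [r], are replaced by 0 to make every
     summand measurable. *)
  rewrite /G (_ : (fun x => _) = fun x => \sum_(I <- r)
      (of_real F (if `[< measurable I.1 >] then \1_(I.1) x else 0) *: u I)).
    apply: measurable_mx_sum => I; apply: measurable_mxZ; last exact: measurable_mx_cst.
    case: asboolP => mI; first exact: measurable_indic.
    exact: measurable_cst.
  apply/funext => x; rewrite big_seq [RHS]big_seq; apply: eq_bigr => I /mr mI.
  by have -> : `[< measurable I.1 >] = true by apply/asboolP.
pose k x := W x *m G x.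
have hG : has_int sigma setT (fun x => dot (h x) (G x)) (finite_carleson_sum h r).
  rewrite /finite_carleson_sum.
  have -> : (fun x => dot (h x) (G x)) =
      fun x => \sum_(I <- r) \1_(I.1) x * dot (h x) (u I).
    by apply/funext => x; rewrite dot_sumr; apply: eq_bigr => I _; rewrite dotZr.
  apply: has_int_sum => // I Ir; have [aI s0] := ar I Ir.
  have gI := atom_good aI; have [mI _ iI] := gI.
  rewrite dotC -dot_integral_average // -/(u I); apply: has_int_indic => //.
  apply: has_int_dot => //; apply: integral_mxP => //.
  exact: dominated_integrable_mx dom mI iI.
have kG : has_int sigma setT (fun x => dot (k x) (G x))
    (\sum_(I <- r) mass I * dot (average sigma I.1 k) (u I)).
  have -> : (fun x => dot (k x) (G x)) =
      fun x => \sum_(I <- r) \1_(I.1) x * dot (k x) (u I).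
    by apply/funext => x; rewrite dot_sumr; apply: eq_bigr => I _; rewrite dotZr.
  apply: has_int_sum => // I Ir; have [aI s0] := ar I Ir.
  have gI := atom_good aI; have [mI _ iI] := gI.
  rewrite -dot_integral_average //; apply: has_int_indic => //.
  apply: has_int_dot => //; apply: integral_mxP => //.
  exact: integrable_mx_steps.
set N := finite_carleson_sum h r in hG *.
set g := \sum_(I <- r) _ in kG.
have sqG : sqnorm_L2W sigma W G = g%:E.
  by rewrite -(has_int_ereal measurableT kG).
have embG : finite_carleson_sum k r <= a * g.
  have : (carleson_sum Fil A k <= (a * g)%:E)%E.
    by rewrite EFinM -sqG; apply: emb; split=> //; rewrite sqG ltry.
  by move/carleson_sum_le; apply=> // I /ar[].
(* The embedding at [G] bounds the sum for [k] by [a g], so [2 g <= g + a N]. *)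
have gN : g <= a * N.
  have : 2 * g <= a^-1 * finite_carleson_sum k r + a * N.
    rewrite /g /N /finite_carleson_sum !mulr_sumr -big_split big_seq [leRHS]big_seq /=.
    apply: ler_sum => I /ar[aI s0].
    have m0 := mass_gt0 aI s0.
    have ai : 0 < a^-1 by rewrite invr_gt0.
    have := @psd_mixed_le _ _ hF _ _ (average sigma I.1 k) (average sigma I.1 h)
      _ (hA aI) ai.
    rewrite invrK (dot_adjoint (A I) (average sigma I.1 k)) psd_herm; last exact: hA.
    rewrite -/(u I) => le1.
    rewrite mulrCA [a^-1 * _]mulrCA [a * _]mulrCA -mulrDr ler_pM2l //.
  have : a^-1 * finite_carleson_sum k r <= g by rewrite ler_pdivrMl.
  by lra.
(* Integrate the domination of [h] at [G / a]; then [g <= a N] absorbs one of the two copies of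
   [N]. *)
have : 2 * N <= a * \int[sigma]_x psi x + a^-1 * g.
  have hpsi : has_int sigma setT psi (\int[sigma]_x psi x).
    by split=> //; exact: dominated_integrable dom.
  apply: (has_int_le measurableT (has_intZ measurableT 2 hG)
    (has_intD measurableT (has_intZ measurableT a hpsi) (has_intZ measurableT a^-1 kG))).
  move=> x; have := le_h x (of_real F a^-1 *: G x).
  rewrite dotZr -scalemxAr dotZl dotZr -/(k x) => le1.
  rewrite -(ler_pM2l (_ : 0 < a^-1)) ?invr_gt0 //.
  rewrite mulrDr mulKf ?gt_eqF //.
  by apply: le_trans le1; rewrite mulrCA.
have : a^-1 * g <= N by rewrite ler_pdivrMl.
by lra.
Qed.

Lemma L2_dominated (f : X -> 'cV[F]_d) : in_L2 sigma f ->
  dominated (fun x => psd_sqrt (W x) *m f x) (fun x => dot (f x) (f x)).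
Proof.
move=> [mf ff]; have [mW pW _] := hW.
split.
- by apply: measurable_mxM => //; exact: measurable_psd_sqrt.
- exact: measurable_dot.
- by move=> x; exact: dot_ge0.
- by move: ff; rewrite /sqnorm_L2; under eq_integral do rewrite vnormE.
- move=> x v; have pS : psd (psd_sqrt (W x)) by exact: psd_sqrt_psd.
  rewrite dot_adjoint psd_herm //.
  have := @psd_mixed_le _ _ hF _ _ (f x) (psd_sqrt (W x) *m v) 1 (@psd1 _ _ hF d) ltr01.
  by rewrite invr1 !mul1r !mul1mx dot_psd_sqrt.
Qed.

Lemma L2W_dominated (f : X -> 'cV[F]_d) : in_L2W sigma W f ->
  dominated (fun x => W x *m f x) (fun x => dot (W x *m f x) (f x)).
Proof.
move=> [mf ff]; have [mW pW _] := hW.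
have mWf : measurable_mx (fun x => W x *m f x) by exact: measurable_mxM.
split=> //.
- exact: measurable_dot.
- by move=> x; exact: psd_ge0.
- move=> x v; have := @psd_mixed_le _ _ hF _ _ (f x) v 1 (pW x) ltr01.
  by rewrite invr1 !mul1r.
Qed.

Lemma eq_integral_mx m n (E : set X) (G H : X -> 'M[F]_(m, n)) :
  (forall x, E x -> G x = H x) -> integral_mx sigma E G = integral_mx sigma E H.
Proof.
move=> e; apply/matrixP => i j; rewrite !mxE; congr (of_re_im F _ _).
  by apply: eq_Rintegral => x; rewrite inE => /e ->.
by apply: eq_Rintegral => x; rewrite inE => /e ->.
Qed.

(** Test on [f = 1_I0 v]: for [I] inside [I0] the average of [W f] is [<W>_I v]. *)
Lemma packing_of_embedding (a : R) : embedding_L2W Fil W A a -> packing_sums a.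
Proof.
move=> emb I0 aI0 s0 r v ur ar; have [mW pW _] := hW.
have [mI0 _ iI0] := atom_good aI0.
pose f x := of_real F (\1_(I0.1) x) *: v.
have mf : measurable_mx f.
  apply: measurable_mxZ; last exact: measurable_mx_cst.
  exact: measurable_indic.
have sqf : sqnorm_L2W sigma W f =
    (mass I0 * dot (average sigma I0.1 W *m v) v)%:E.
  rewrite -dotZl scalemxAl -integral_averageE //.
  have hv : has_int sigma I0.1 (fun x => dot (W x *m v) v)
      (dot (integral_mx sigma I0.1 W *m v) v).
    by apply: has_int_dot => //; apply: has_int_mxM => //; exact: integral_mxP.
  rewrite -(has_int_ereal measurableT (has_int_indic mI0 hv)).
  apply: eq_integral => x _; congr (_%:E).
  rewrite -[LHS]/(dot _ _) /f -scalemxAr dotZl dotZr mulrA indicE.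
  by case: (_ \in _); rewrite ?mulr1 ?mulr0.
have : (carleson_sum Fil A (fun x => W x *m f x) <=
    (a * (mass I0 * dot (average sigma I0.1 W *m v) v))%:E)%E.
  by rewrite EFinM -sqf; apply: emb; split=> //; rewrite sqf ltry.
move/carleson_sum_le => /(_ r ur) le1.
apply: le_trans (le1 _); last by move=> I /ar[].
rewrite le_eqVlt; apply/orP; left; apply/eqP.
rewrite /finite_carleson_sum big_seq [RHS]big_seq; apply: eq_bigr => I /ar[aI [II0 _]].
have -> : average sigma I.1 (fun x => W x *m f x) = average sigma I.1 W *m v.
  have [z|z] := eqVneq (sigma I.1) 0%E; first by rewrite !average_null // mul0mx.
  have [mI _ iI] := atom_good aI.
  rewrite !averageE // -scalemxAl; congr (_ *: _).
  rewrite -(has_int_mxP (has_int_mxM mI v (integral_mxP mI iI))).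
  apply: eq_integral_mx => x Ix; rewrite /f indicE mem_set ?of_real1 ?scale1r //.
  exact: II0.
by rewrite -!mulmxA dot_adjoint (psd_herm (average_psd aI)).
Qed.

(** * Convergence of the matrix packing sum *)

Definition partial_packing (D : set (set X * int)) (J : {fset set X * int}) : 'M[F]_d :=
  \sum_(I <- J | I \in D) of_real F (mass I) *:
    (average sigma I.1 W *m A I *m average sigma I.1 W).

Lemma partial_packing_psd I0 J : psd (partial_packing (atoms_in Fil I0) J).
Proof.
apply: psd_sum => I; rewrite inE => -[aI _].
by apply: psdZ; [exact: mass_ge0|exact: packing_term_psd].
Qed.

Lemma partial_packing_le I0 (J K : {fset set X * int}) v : (J `<=` K)%fset ->
  dot (partial_packing (atoms_in Fil I0) J *m v) v <=
  dot (partial_packing (atoms_in Fil I0) K *m v) v.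
Proof.
move=> JK; set D := atoms_in Fil I0.
have -> : partial_packing D K = partial_packing D J +
    \sum_(I <- K | (I \in D) && (I \notin J)) of_real F (mass I) *:
    (average sigma I.1 W *m A I *m average sigma I.1 W).
  rewrite /partial_packing (bigID [in J]) /=; congr (_ + _).
  rewrite -big_filter -[RHS]big_filter; apply: perm_big.
  apply: uniq_perm; [exact/filter_uniq/fset_uniq|exact/filter_uniq/fset_uniq|].
  move=> I; rewrite !mem_filter -andbA; case: (I \in D) => //=.
  by case: (boolP (I \in J)) => //= /(fsubsetP JK).
rewrite mulmxDl dotDl lerDl; apply: psd_ge0; apply: psd_sum => I /andP[].
rewrite inE => -[aI _] _.
by apply: psdZ; [exact: mass_ge0|exact: packing_term_psd].
Qed.

Lemma dot_partial_packing I0 (r : seq (set X * int)) v :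
  uniq r -> (forall I, I \in r -> atoms_in Fil I0 I) ->
  dot (partial_packing (atoms_in Fil I0) [fset I in r]%fset *m v) v =
  \sum_(I <- r) mass I *
    dot ((average sigma I.1 W *m A I *m average sigma I.1 W) *m v) v.
Proof.
move=> ur ar; rewrite /partial_packing.
rewrite (perm_big r) /=; last first.
  by apply: uniq_perm; [exact: fset_uniq|exact: ur|move=> I; rewrite !inE].
rewrite mulmx_suml dot_suml big_seq_cond [RHS]big_seq.
apply: eq_big => [I|I _]; last by rewrite -scalemxAl dotZl.
by case: (boolP (I \in r)) => // /ar/mem_set ->.
Qed.

Lemma cvg_totally_sup (T : choiceType) (f : {fset T} -> R) (b : R) :
  (forall J K, (J `<=` K)%fset -> f J <= f K) -> (forall J, f J <= b) ->
  f @ totally --> sup (range f).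
Proof.
move=> incr bnd; have PF : ProperFilter (@totally T) by exact: totally_filter.
have hs : has_sup (range f).
  split; first by exists (f fset0), fset0.
  by exists b => _ [J _ <-].
apply/cvgrPdist_le => e e0.
have [_ [J _ <-] Je] := sup_adherent e0 hs.
exists J => // K /= /incr JK.
have K_le : f K <= sup (range f) by apply: ub_le_sup; [have [] := hs|exists K].
by rewrite ler_norml; apply/andP; split; lra.
Qed.

(** The forms of the partial sums increase. A limit therefore dominates each of them; conversely,
    bounded forms tend to their suprema, and polarization supplies the limit matrix. *)
Lemma carleson_packingP (c : R) : carleson_packing Fil W A c <-> packing_sums c.
Proof.
have PF : ProperFilter (@totally (set X * int)%type) by exact: totally_filter.
split=> [pack I0 aI0 s0 r v ur ar|pack I0 aI0 s0].
  have [S /cvg_entriesP hS le_S] := pack I0 aI0 s0.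
  have hP : cvg_entries totally (partial_packing (atoms_in Fil I0)) S by [].
  have m0 := mass_gt0 aI0 s0.
  have hermS : adjoint S = S.
    by apply: cvg_entries_herm hP => J; exact/psd_herm/partial_packing_psd.
  have {}le_S : dot (S *m v) v <= c * (mass I0 * dot (average sigma I0.1 W *m v) v).
    have h1 : adjoint (of_real F (mass I0)^-1 *: S) = of_real F (mass I0)^-1 *: S.
      by rewrite adjointZ hermS.
    have h2 : adjoint (of_real F c *: average sigma I0.1 W) =
        of_real F c *: average sigma I0.1 W.
      by rewrite adjointZ (psd_herm (average_psd aI0)).
    move: ((@loewner_leP _ _ hF _ _ _ h1 h2).1 le_S v).
    by rewrite -!scalemxAl !dotZl mulrC ler_pdivrMr // -mulrA [_ * mass I0]mulrC.
  apply: le_trans le_S; rewrite -(dot_partial_packing v ur ar).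
  apply: (cvg_geR (@cvg_entries_dot _ _ hF _ _ PF _ _ _ v hP)).
  by exists [fset I in r]%fset => // K /= JK; exact: partial_packing_le.
have m0 := mass_gt0 aI0 s0.
pose q v J := dot (partial_packing (atoms_in Fil I0) J *m v) v.
have q_le v J : q v J <= c * (mass I0 * dot (average sigma I0.1 W *m v) v).
  pose r := [seq I <- J | I \in atoms_in Fil I0].
  have ur : uniq r by exact/filter_uniq/fset_uniq.
  have ar I : I \in r -> atoms_in Fil I0 I by rewrite mem_filter => /andP[/set_mem].
  apply: le_trans (pack I0 aI0 s0 r v ur ar).
  rewrite /q /partial_packing -big_filter mulmx_suml dot_suml.
  by apply: ler_sum => I _; rewrite -scalemxAl dotZl.
have q_cvg v : q v @ totally --> sup (range (q v)).
  apply: cvg_totally_sup (q_le v) => J K; exact: partial_packing_le.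
have hP : cvg_entries totally (partial_packing (atoms_in Fil I0))
    (mx_of_form (fun v => sup (range (q v)))).
  by apply: cvg_entries_form => // J; exact/psd_herm/partial_packing_psd.
set S := mx_of_form _ in hP.
have hermS : adjoint S = S.
  by apply: cvg_entries_herm hP => J; exact/psd_herm/partial_packing_psd.
exists S; first exact/cvg_entriesP.
apply: (loewner_leP _ _).2; rewrite ?adjointZ ?hermS ?(psd_herm (average_psd aI0)) // => v.
rewrite -!scalemxAl !dotZl -/(mass I0) mulrC ler_pdivrMr //.
rewrite -mulrA [_ * mass I0]mulrC.
apply: (cvg_leR (@cvg_entries_dot _ _ hF _ _ PF _ _ _ v hP)).
by apply: nearW => J; exact: q_le.
Qed.

Lemma finite_carleson_sum_nonnull g (r : seq (set X * int)) :
  finite_carleson_sum g r =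
  finite_carleson_sum g [seq I <- r | sigma I.1 != 0%E].
Proof.
rewrite /finite_carleson_sum big_filter [RHS]big_mkcond; apply: eq_bigr => I _.
by case: eqP => // s0; rewrite average_null // mulmx0 dot0l mulr0.
Qed.

Lemma carleson_dominated c h psi (r : seq (set X * int)) :
  0 < c -> packing_sums c -> dominated h psi -> uniq r ->
  (forall I, I \in r -> all_atoms Fil I) ->
  finite_carleson_sum h r <= 4 * d%:R ^+ 2 * c * \int[sigma]_x psi x.
Proof.
move=> c0 pack dom ur ar; rewrite finite_carleson_sum_nonnull.
apply: carleson_dominated_pos => //; first exact: filter_uniq.
by move=> I; rewrite mem_filter => /andP[s0 /ar].
Qed.

(** The common shape of the three conditions. For [m >= 0] the set of such [c] is closed and
    contains every larger number; hence best constants exist, and a proof may first enlarge [c]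
    slightly. *)
Definition upper_bounds (T : Type) (Q : T -> Prop) (l m : T -> R) (c : R) : Prop :=
  forall i, Q i -> l i <= c * m i.

Definition test_L2 (i : (X -> 'cV[F]_d) * seq (set X * int)) : Prop :=
  [/\ in_L2 sigma i.1, uniq i.2 & forall I, I \in i.2 -> all_atoms Fil I].

Definition test_L2W (i : (X -> 'cV[F]_d) * seq (set X * int)) : Prop :=
  [/\ in_L2W sigma W i.1, uniq i.2 & forall I, I \in i.2 -> all_atoms Fil I].

Lemma dominated_ereal h psi : dominated h psi ->
  (\int[sigma]_x (psi x)%:E)%E = (\int[sigma]_x psi x)%:E.
Proof.
move=> dom; apply: has_int_ereal => //; split=> //.
exact: dominated_integrable dom.
Qed.

Lemma embedding_L2P c : embedding_L2 Fil W A c <->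
  upper_bounds test_L2
    (fun i => finite_carleson_sum (fun x => psd_sqrt (W x) *m i.1 x) i.2)
    (fun i => \int[sigma]_x dot (i.1 x) (i.1 x)) c.
Proof.
have sq (f : X -> 'cV[F]_d) : in_L2 sigma f ->
    sqnorm_L2 sigma f = (\int[sigma]_x dot (f x) (f x))%:E.
  move=> /L2_dominated/dominated_ereal <-.
  by rewrite /sqnorm_L2; under eq_integral do rewrite vnormE.
split=> [emb [f r] [/= fL ur ar]|bnd f fL].
  by move: (emb f fL); rewrite sq // -EFinM => /carleson_sum_le; apply.
rewrite sq // -EFinM; apply/carleson_sum_le => r ur ar.
exact: (bnd (f, r)).
Qed.

Lemma embedding_L2WP c : embedding_L2W Fil W A c <->
  upper_bounds test_L2W
    (fun i => finite_carleson_sum (fun x => W x *m i.1 x) i.2)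
    (fun i => \int[sigma]_x dot (W x *m i.1 x) (i.1 x)) c.
Proof.
have sq (f : X -> 'cV[F]_d) : in_L2W sigma W f ->
    sqnorm_L2W sigma W f = (\int[sigma]_x dot (W x *m f x) (f x))%:E.
  by move=> /L2W_dominated/dominated_ereal <-.
split=> [emb [f r] [/= fL ur ar]|bnd f fL].
  by move: (emb f fL); rewrite sq // -EFinM => /carleson_sum_le; apply.
rewrite sq // -EFinM; apply/carleson_sum_le => r ur ar.
exact: (bnd (f, r)).
Qed.

Definition test_packing (i : (set X * int) * seq (set X * int) * 'cV[F]_d) : Prop :=
  [/\ all_atoms Fil i.1.1, sigma i.1.1.1 != 0%E, uniq i.1.2 &
      forall I, I \in i.1.2 -> atoms_in Fil i.1.1 I].

Lemma packing_sumsP c : carleson_packing Fil W A c <->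
  upper_bounds test_packing
    (fun i => \sum_(I <- i.1.2) mass I *
      dot ((average sigma I.1 W *m A I *m average sigma I.1 W) *m i.2) i.2)
    (fun i => mass i.1.1 * dot (average sigma i.1.1.1 W *m i.2) i.2) c.
Proof.
split=> [/carleson_packingP pack [[I0 r] v] [/= aI s0 ur ar]|bnd].
  exact: pack.
by apply/carleson_packingP => I0 aI0 s0 r v ur ar; exact: (bnd (I0, r, v)).
Qed.

Section UpperBounds.
Variables (T : Type) (Q : T -> Prop) (l m : T -> R).
Hypothesis m0 : forall i, Q i -> 0 <= m i.

Lemma upper_bounds_le c c' : c <= c' ->
  upper_bounds Q l m c -> upper_bounds Q l m c'.
Proof. by move=> cc h i Qi; apply: le_trans (h i Qi) _; rewrite ler_wpM2r ?m0. Qed.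

Lemma upper_bounds_closed c :
  (forall e, 0 < e -> upper_bounds Q l m (c + e)) -> upper_bounds Q l m c.
Proof.
move=> h i Qi; apply: (@ler_addeps _ _ _ (m i)); first exact: m0.
by move=> e e0; rewrite -mulrDl; exact: h.
Qed.

Lemma best_upper_bound (P : R -> Prop) :
  (forall c, P c <-> upper_bounds Q l m c) ->
  (exists c, admissible P c) -> exists c, best_constant P c.
Proof.
move=> PE [c1 [c10 Pc1]]; pose S := [set c | admissible P c].
have S0 : has_inf S.
  by split; [exists c1|exists 0 => c []].
exists (inf S); split; last by move=> c Sc; apply: ge_inf => //; have [] := S0.
split; first by apply: lb_le_inf; [exists c1|move=> c []].
apply/PE/upper_bounds_closed => e e0.
have [c [_ /PE Pc] lt_c] := inf_adherent e0 S0.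
exact: upper_bounds_le (ltW lt_c) Pc.
Qed.

End UpperBounds.

Lemma test_L2_ge0 i : test_L2 i -> 0 <= \int[sigma]_x dot (i.1 x) (i.1 x).
Proof. by move=> _; apply: Rintegral_ge0 => x _; exact: dot_ge0. Qed.

Lemma test_L2W_ge0 i : test_L2W i -> 0 <= \int[sigma]_x dot (W x *m i.1 x) (i.1 x).
Proof.
by move=> _; have [_ pW _] := hW; apply: Rintegral_ge0 => x _; exact: psd_ge0.
Qed.

Lemma test_packing_ge0 i : test_packing i ->
  0 <= mass i.1.1 * dot (average sigma i.1.1.1 W *m i.2) i.2.
Proof.
by move=> [aI _ _ _]; rewrite mulr_ge0 ?mass_ge0 //; exact/psd_ge0/average_psd.
Qed.

(** * Implications between the three conditions *)

Lemma embedding_L2_L2W c : embedding_L2 Fil W A c -> embedding_L2W Fil W A c.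
Proof.
move=> emb f [mf ff]; have [mW pW _] := hW.
pose g x := psd_sqrt (W x) *m f x.
have sqg : sqnorm_L2 sigma g = sqnorm_L2W sigma W f.
  apply: eq_integral => x _; congr (_%:E).
  by rewrite vnormE /g dot_psd_sqrt.
have gL : in_L2 sigma g.
  split; last by rewrite sqg.
  by apply: measurable_mxM => //; exact: measurable_psd_sqrt.
have := emb g gL; rewrite sqg.
rewrite (_ : (fun x => psd_sqrt (W x) *m g x) = (fun x => W x *m f x)) //.
by apply/funext => x; rewrite /g mulmxA psd_sqrtK.
Qed.

(** [W] may be singular, so a function in L2 need not have the form [W^(1/2) f]; duality takes the
    place of the substitution. It asks for a positive constant, whence [c + e]. *)
Lemma embedding_L2W_L2 c : 0 <= c ->
  embedding_L2W Fil W A c -> embedding_L2 Fil W A c.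
Proof.
move=> c0 /embedding_L2WP emb; apply/embedding_L2P.
apply: (upper_bounds_closed test_L2_ge0) => e e0 [f r] [/= fL ur ar].
have ce : 0 < c + e by rewrite ltr_wpDl.
rewrite finite_carleson_sum_nonnull.
apply: (embedding_duality ce _ (L2_dominated fL)).
- apply/embedding_L2WP; apply: upper_bounds_le emb; first exact: test_L2W_ge0.
  by rewrite lerDl ltW.
- exact: filter_uniq.
- by move=> I; rewrite mem_filter => /andP[s0 /ar].
Qed.

Lemma embedding_L2W_packing c : embedding_L2W Fil W A c -> carleson_packing Fil W A c.
Proof. by move=> /packing_of_embedding/carleson_packingP. Qed.

Lemma packing_embedding_L2W c : 0 <= c -> carleson_packing Fil W A c ->
  embedding_L2W Fil W A (4 * d%:R ^+ 2 * c).
Proof.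
move=> c0 /packing_sumsP pack; apply/embedding_L2WP.
apply: (upper_bounds_closed test_L2W_ge0) => e e0 [f r] [/= fL ur ar].
pose k : R := 4 * d%:R ^+ 2.
have k0 : 0 <= k by rewrite mulr_ge0 // sqr_ge0.
(* The increment makes the constant positive and costs at most [e] after multiplication by [k]. *)
pose c' := c + e / (k + 1).
have k1 : 0 < k + 1 by rewrite ltr_wpDl.
have c'0 : 0 < c' by rewrite ltr_wpDl // divr_gt0.
have pack' : packing_sums c'.
  apply/carleson_packingP/packing_sumsP; apply: upper_bounds_le pack.
    exact: test_packing_ge0.
  by rewrite lerDl divr_ge0 // ltW.
have := carleson_dominated c'0 pack' (L2W_dominated fL) ur ar.
move/le_trans; apply; apply: ler_wpM2r.
  by apply: (test_L2W_ge0 (i := (f, r))).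
rewrite -/k /c' mulrDr lerD2l mulrCA; apply: ler_piMr; first exact: ltW.
by rewrite ler_pdivrMr // mul1r lerDl.
Qed.

End Embeddings.

Theorem theorem1p2 (R : realType) (F : scalars R)
  (hF : F = real_scalars R \/ F = complex_scalars R)
  (disp : measure_display) (X : measurableType disp)
  (sigma : {measure set X -> \bar R}) (hsigma : sigma_finite [set: X] sigma)
  (Fil : atomic_filtration sigma)
  (d : nat) (W : X -> 'M[F]_d) (hW : matrix_weight Fil W)
  (A : set X * int -> 'M[F]_d) (hA : forall I, all_atoms Fil I -> psd (A I)) :
  [/\ (exists a, admissible (embedding_L2 Fil W A) a) <->
        (exists a, admissible (embedding_L2W Fil W A) a),
      (exists a, admissible (embedding_L2W Fil W A) a) <->
        (exists b, admissible (carleson_packing Fil W A) b),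
      (forall a, admissible (embedding_L2 Fil W A) a <->
                 admissible (embedding_L2W Fil W A) a) &
      (exists a, admissible (embedding_L2 Fil W A) a) ->
      exists a b,
        [/\ best_constant (embedding_L2 Fil W A) a,
            best_constant (embedding_L2W Fil W A) a,
            best_constant (carleson_packing Fil W A) b,
            b <= a &
            a <= 4 * expR 1 ^+ 2 * d%:R ^+ 2 * b]].
Proof.
have hF' : real_or_complex F := hF.
have L2_L2W a : admissible (embedding_L2 Fil W A) a <->
    admissible (embedding_L2W Fil W A) a.
  split=> -[a0 emb]; split=> //; first exact: embedding_L2_L2W.
  exact: embedding_L2W_L2.
have L2W_pack : (exists a, admissible (embedding_L2W Fil W A) a) <->
    (exists b, admissible (carleson_packing Fil W A) b).
  split=> -[c [c0 h]].
    by exists c; split=> //; exact: embedding_L2W_packing.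
  exists (4 * d%:R ^+ 2 * c); split; first by rewrite !mulr_ge0 ?sqr_ge0.
  exact: packing_embedding_L2W.
have L2_ex : (exists a, admissible (embedding_L2 Fil W A) a) <->
    (exists a, admissible (embedding_L2W Fil W A) a).
  by split=> -[a h]; exists a; exact/L2_L2W.
split=> // exa.
have [a bestW] : exists a, best_constant (embedding_L2W Fil W A) a.
  apply: (best_upper_bound (@test_L2W_ge0 _ _ hF' _ _ _ _ _ _ hW)).
    exact: embedding_L2WP.
  exact/L2_ex.
have [b bestP] : exists b, best_constant (carleson_packing Fil W A) b.
  apply: (best_upper_bound (@test_packing_ge0 _ _ hF' _ _ _ _ _ _ hW)).
    exact: packing_sumsP.
  exact/L2W_pack/L2_ex.
exists a, b; have [[a0 embW] leW] := bestW; have [[b0 pack] leP] := bestP.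
split=> //.
- by split=> [|c /L2_L2W]; [exact/L2_L2W|exact: leW].
- by apply: leP; split=> //; exact: embedding_L2W_packing.
- apply: (@le_trans _ _ (4 * d%:R ^+ 2 * b)).
    apply: leW; split; first by rewrite !mulr_ge0 ?sqr_ge0.
    exact: packing_embedding_L2W.
  (* The argument gives [4 d ^ 2]; the stated constant is larger by the square of [expR 1], which is
     at least 1. *)
  rewrite ler_wpM2r // -mulrA ler_pM2l // ler_peMl ?sqr_ge0 //.
  by rewrite exprn_ege1 // -{1}expR0 ler_expR.
Qed.
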